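(* Let $g,u\ge 4$ be integers with $g\equiv 1\pmod 3$, and let $m$ be a positive integer with $m\le (u-1)/2$. Suppose that either $u\equiv 0\pmod{12}$ and $m\equiv 1\pmod 3$, or $u\equiv 3\pmod{12}$ and $m\equiv 1\pmod 6$, or $u\equiv 9\pmod{12}$ and $m\equiv 4\pmod 6$. Then there exists a 4-GDD of type $g^u m^1$.
   Context: A 4-GDD of type $g_1^{u_1}\cdots g_r^{u_r}$ is a triple $(V,\mathcal G,\mathcal B)$ where $V$ is a set of $u_1g_1+\cdots+u_rg_r$ points, $\mathcal G$ is a partition of $V$ into $u_i$ groups of size $g_i$ for each $i$, and $\mathcal B$ is a non-empty collection of 4-element subsets (blocks) such that every pair of points from distinct groups lies in exactly one block and no pair from the same group lies in any block. *)

(* Defs.v *)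
From mathcomp Require Import all_boot.
Set Implicit Arguments. Unset Strict Implicit. Unset Printing Implicit Defensive.

Definition is_4GDD (T : finType) (G B : {set {set T}}) : Prop :=
  [/\ partition G [set: T],
      B != set0,
      (forall b, b \in B -> #|b| = 4),
      (forall x y : T, x != y -> pblock G x != pblock G y ->
         #|[set b in B | (x \in b) && (y \in b)]| = 1)
    & (forall x y : T, x != y -> pblock G x = pblock G y ->
         forall b, b \in B -> ~~ ((x \in b) && (y \in b)))].

Definition has_type (T : finType) (G : {set {set T}}) (ty : nat -> nat) : Prop :=
  forall s : nat, #|[set X in G | #|X| == s]| = ty s.

(* Existence of a 4-GDD of type g^u m^1 (multiplicities add up if m = g). *)
Definition exists_4GDD_gu_m1 (g u m : nat) : Prop :=
  exists (T : finType) (G B : {set {set T}}),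
    is_4GDD G B /\ has_type G (fun s => (s == g) * u + (s == m)).

(* Main.v *)
Require Import Defs.
From mathcomp Require Import all_boot zify.
From Stdlib Require Import NArith.
Set Implicit Arguments. Unset Strict Implicit. Unset Printing Implicit Defensive.

(** With u = 3s, a 4-GDD of type g^u m^1 is a decomposition into K_4's of the complete multipartite
    graph with u parts of size g and one of size m.  Write s = 4n + r with r <= n and take a
    transversal design with six groups of size n.  Each point of the first four groups, and each of
    r points of the fifth one, is replaced by three g-parts; at most one further point of the fifth
    group is replaced by 3 points of the m-part, and some points of the sixth one by 6 points of the
    m-part.  The blocks are filled with 4-GDDs of types (3g)^4 x^1 and (3g)^5 x^1, the groups with
    4-GDDs of types g^(3n) w^1 and g^(3r) w'^1.  This is an induction on s with finitely many starting
    values.  For these, the graph is the union of g copies of the case g = 1 and of the tensor product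
    K_u x K_g.  The latter can be decomposed as soon as K_u x K_k can for k = 4, 7, 10, 19, because
    K_g decomposes into complete graphs of these orders for all g = 1 mod 3.  What is left is a
    finite list of designs, which are verified by computation. *)

(** The bound [m <= (u - 1) / 2] is the necessary one for type 1^u m^1, which is why [g] copies of
    the case g = 1, sharing the part of size [m], are available at all. It also explains the
    weights. With s = 4n + r the bound 2m < 3s reads 2(m - 6n) < 3r, so a sixth group with n points
    of weight 6 leaves exactly the bound for the filling of the fifth group. Weight 6 does not
    change m mod 6, while n mod 4 prescribes w mod 6; the single point of weight 3 repairs a
    discrepancy of 3, and as r = s mod 4, the filling of the fifth group then satisfies the same
    congruences as (s, m). The obstacle is uniformity in g. Types (3g)^4 6^1 and (3g)^4 9^1 cannot
    be cut into rows of width 3, because a 4-GDD of type 3^4 x^1 has x <= 4. This is where g >= 4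
    enters, and where a transversal design of order g with five groups is wanted, which the arrays
    built here do not provide for g = 10 mod 12. *)

(* Decompositions of the graph [R] (whose diagonal is ignored) into cliques with sizes in [K]. *)
Definition kdec (T : eqType) (K : pred nat) (R : rel T) : Prop :=
  exists B : seq (seq T), (forall b, b \in B -> uniq b /\ K (size b)) /\
    forall x y, x != y -> count (fun b => (x \in b) && (y \in b)) B = R x y.

Notation dec := (kdec (pred1 4)).

(** * Assembling and transporting clique decompositions *)

Lemma eq_kdec (T : eqType) K (R R' : rel T) :
  (forall x y, x != y -> R x y = R' x y) -> kdec K R -> kdec K R'.
Proof. by move=> eR [B [hB cB]]; exists B; split=> // x y xy; rewrite cB ?eR. Qed.

Lemma kdec_sum (T : eqType) K (I : eqType) (s : seq I) (Q : I -> rel T) (R : rel T) :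
    (forall i, i \in s -> kdec K (Q i)) ->
    (forall x y, x != y -> \sum_(i <- s) (Q i x y : nat) = R x y) ->
  kdec K R.
Proof.
move=> hQ eR.
suff [B [hB cB]] : exists B : seq (seq T), (forall b, b \in B -> uniq b /\ K (size b)) /\
    forall x y, x != y -> count (fun b => (x \in b) && (y \in b)) B =
      \sum_(i <- s) (Q i x y : nat).
  by exists B; split=> // x y xy; rewrite cB ?eR.
elim: s hQ {eR} => [|i s IHs] hQ; first by exists [::]; split=> // x y _; rewrite big_nil.
have [|B [hB cB]] := IHs; first by move=> j js; apply: hQ; rewrite inE js orbT.
have [A [hA cA]] := hQ i (mem_head _ _).
exists (A ++ B); split=> [b|x y xy]; first by rewrite mem_cat => /orP[/hA|/hB].
by rewrite count_cat big_cons cA ?cB.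
Qed.

(** Edges are sorted by a label, so the classes are disjoint and their decompositions add up. Most
    constructions below amount to the choice of a label. *)
Lemma kdec_key (T : eqType) K (I : eqType) (s : seq I) (k : T -> T -> I) (R : rel T) :
    uniq s -> (forall i, i \in s -> kdec K (fun x y => R x y && (k x y == i))) ->
    (forall x y, x != y -> R x y -> k x y \in s) ->
  kdec K R.
Proof.
move=> us hQ hk; apply: (kdec_sum (Q := fun i x y => R x y && (k x y == i))) hQ _.
move=> x y xy; have [Rxy|_] := boolP (R x y); last by rewrite big1.
rewrite (bigD1_seq (k x y)) ?hk //= eqxx big1 // => i.
by rewrite eq_sym => /negPf->.
Qed.

(** The hypotheses make [f] an isomorphism of [R1] onto [R2] up to isolated vertices; each change of
    coordinates thereby reduces to arithmetic. *)
Lemma kdec_map (T1 T2 : eqType) K (S : pred T1) (f : T1 -> T2) (R1 : rel T1) (R2 : rel T2) :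
    {in S &, injective f} ->
    (forall a b, a != b -> R1 a b -> S a /\ S b) ->
    (forall a b, S a -> S b -> a != b -> R2 (f a) (f b) = R1 a b) ->
    (forall x y, x != y -> R2 x y -> exists a b, [/\ S a, S b, x = f a & y = f b]) ->
  kdec K R1 -> kdec K R2.
Proof.
move=> finj hS hR hsup [B [hB cB]].
have clB b a c : b \in B -> a \in b -> c \in b -> a != c -> R1 a c.
  move=> bB ab cb ac; apply/negPn/negP => nR.
  have /eqP := cB _ _ ac; rewrite (negPf nR) eqn0Ngt -has_count => /hasP[].
  by exists b; rewrite ?ab.
(* A block with at least two points lies in [S], since each of its points has a neighbour in the
   block. *)
have SB b : b \in B -> 1 < size b -> {subset b <= S}.
  move=> bB b1 a ab; have [ub _] := hB _ bB.
  have [c cb ca] : exists2 c, c \in b & a != c.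
    case: b ub b1 ab bB => [|x [|y b]] //= /andP[].
    rewrite inE negb_or => /andP[xy _] _ _ _ _.
    have [->|ax] := eqVneq a x; first by exists y; rewrite ?inE ?eqxx ?orbT.
    by exists x; rewrite ?inE ?eqxx.
  by have [] := hS _ _ ca (clB _ _ _ bB ab cb ca).
(* Blocks with at most one point cover no pair but may lie outside [S], where [f] can merge points;
   they are dropped. *)
exists [seq map f b | b <- B & 1 < size b]; split.
  move=> c /mapP[b]; rewrite mem_filter => /andP[b1 bB] {c}->; have [ub kb] := hB _ bB.
  rewrite size_map map_inj_in_uniq //.
  by move=> x y /(SB _ bB b1) xS /(SB _ bB b1) yS; apply: finj.
move=> x y xy; rewrite count_map count_filter.
have main a b : S a -> S b -> x = f a -> y = f b ->
    count (fun c => (x \in map f c) && (y \in map f c) && (1 < size c)) B = R2 x y.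
  move=> aS bS ex ey; have ab : a != b by apply: contra_neq xy => ab; rewrite ex ey ab.
  rewrite ex ey hR // -cB //; apply: eq_in_count => c cBm /=.
  have [c1|c1] := ltnP 1 (size c); rewrite ?andbT ?andbF.
    have mem z : S z -> (f z \in map f c) = (z \in c).
      move=> zS; apply/mapP/idP => [[t tc /finj->] //|zc]; last by exists z.
      exact: (SB _ cBm c1).
    by rewrite !mem.
  apply/esym/negP => /andP[ac bc]; move: ab.
  by case: c ac bc c1 {cBm} => [|p [|? ?]] //; rewrite !inE => /eqP-> /eqP->; rewrite eqxx.
have [Rxy|nR] := boolP (R2 x y).
  by have [a [b [aS bS ex ey]]] := hsup _ _ xy Rxy; rewrite (main a b) // Rxy.
apply/eqP; rewrite eqn0Ngt -has_count; apply/negP => /hasP[b bB /=].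
case/andP=> /= /andP[/mapP[a ab ex] /mapP[c cb ey]] b1.
have := main _ _ (SB _ bB b1 _ ab) (SB _ bB b1 _ cb) ex ey.
rewrite (negPf nR) => /eqP; rewrite eqn0Ngt -has_count => /negP[]; apply/hasP; exists b => //=.
by rewrite ex ey !map_f.
Qed.

Lemma kdec_clique (T : eqType) (K : pred nat) (R : rel T) B :
    (forall b, b \in B -> uniq b /\ K (size b)) ->
    (forall x y, x != y -> count (fun b => (x \in b) && (y \in b)) B = R x y) ->
  forall b x y, b \in B -> x \in b -> y \in b -> x != y -> R x y.
Proof.
move=> hB cB b x y bB xb yb xy; apply/negPn/negP => nR.
have /eqP := cB _ _ xy; rewrite (negPf nR) eqn0Ngt -has_count => /hasP[].
by exists b; rewrite ?xb.
Qed.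

(* Wilson's construction: every block [b] of the master design is replaced by a design on the
   points lying above [b]. *)
Lemma kdec_wilson (T T' : eqType) (K K' : pred nat) (p : T' -> T) (R : rel T) (R' : rel T') :
    kdec K R ->
    (forall b, uniq b -> K (size b) ->
       {in b &, forall x y, x != y -> R x y} ->
       kdec K' (fun x y => [&& R' x y, p x != p y, p x \in b & p y \in b])) ->
  kdec K' (fun x y => [&& R' x y, p x != p y & R (p x) (p y)]).
Proof.
move=> [B [hB cB]] hb; have cl := kdec_clique hB cB.
apply: (kdec_sum (s := B)
  (Q := fun b x y => [&& R' x y, p x != p y, p x \in b & p y \in b])).
  by move=> b bB; have [ub kb] := hB _ bB; apply: hb => // x y xb yb; apply: cl bB xb yb.
move=> x y _; have [pxy|] := boolP (R' x y && (p x != p y)).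
  have /andP[-> pxy'] := pxy; rewrite pxy' /= -cB // -sum1_count [RHS]big_mkcond /=.
  by apply: eq_bigr => b _; case: ifP.
by rewrite negb_and => /orP[]/negPf->; rewrite /= ?andbF big1.
Qed.

(** * Computed designs *)

Lemma uniq_map_inj (T1 T2 : eqType) (f : T1 -> T2) s : uniq (map f s) -> {in s &, injective f}.
Proof.
elim: s => //= a s IHs /andP[fa us] x y; rewrite !inE.
case/predU1P=> [->|xs] /predU1P[->|ys] //; last exact: IHs.
  by move=> e; rewrite e map_f in fa.
by move=> e; rewrite -e map_f in fa.
Qed.

Section Orbits.
Variables (T : eqType) (sg : T -> T).
Implicit Types (q : seq T) (base : seq (nat * seq (seq T))).

(* [sg] acts on the points; a pair [(L, qs)] of [base] stands for blocks with orbits of length [L],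
   and a pair [(L, r)] of [orbits] for a point with an orbit of length [L]. *)
Definition blocks base := flatten [seq flatten [seq traject (map sg) q Lq.1 | q <- Lq.2] | Lq <- base].

Definition check (le : rel T) (pts : seq T) (P : pred T) (R : rel T) (orbits : seq (nat * T)) base :=
  let B := blocks base in
  [&& sort le (map sg pts) == pts,
      sort le (flatten [seq traject sg o.2 o.1 | o <- orbits]) == pts,
      all (fun Lq => all (fun q =>
        [&& uniq q, size q == 4, all P q & perm_eq (iter Lq.1 (map sg) q) q]) Lq.2) base
    & all (fun o => sort le (flatten [seq rem o.2 b | b <- B & o.2 \in b]) == filter (R o.2) pts) orbits].

(** The block family is invariant under [sg], hence so is the number of blocks through a pair. It
    therefore suffices to list the companions of one point from each orbit; [check] compares this
    list, as a sorted multiset, with the neighbourhood of the point. *)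
Lemma check_dec le pts (P : pred T) (R : rel T) orbits base :
    uniq pts -> (forall x, (x \in pts) = P x) -> (forall x y, P x -> P y -> R (sg x) (sg y) = R x y) ->
    check le pts P R orbits base ->
  dec (fun x y => [&& P x, P y & R x y]).
Proof.
move=> upts ptsP invR /and4P[/eqP e1 /eqP e2 /allP hb /allP ho].
have perm_sg : perm_eq pts (map sg pts) by rewrite -{1}e1 perm_sort.
have Psg x : P x -> P (sg x) by rewrite -!ptsP => xp; rewrite (perm_mem perm_sg) map_f.
have sg_inj : {in pts &, injective sg} by apply: uniq_map_inj; rewrite -(perm_uniq perm_sg).
have Pmem x b : all P b -> P x -> (sg x \in map sg b) = (x \in b).
  move=> /allP bP xP; apply/mapP/idP => [[y yb /sg_inj->]|xb]; rewrite ?ptsP //; first exact: bP.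
  by exists x.
have PT q n : all P q -> all (all P) (traject (map sg) q n).
  elim: n q => //= n IHn q qP; rewrite qP IHn // all_map; apply: sub_all qP; exact: Psg.
have blockP b : b \in blocks base -> [&& uniq b, size b == 4 & all P b].
  case/flattenP=> _ /mapP[Lq /hb/allP h ->] /flattenP[_ /mapP[q /h/and4P[uq sq qP _] ->]].
  case/trajectP=> i _ ->; elim: i => /= [|i /and3P[ub sb bP]]; first by rewrite uq sq.
  rewrite size_map sb all_map (sub_all Psg) // map_inj_in_uniq ?ub //.
  by move=> x y /(allP bP) xP /(allP bP) yP; apply: sg_inj; rewrite ptsP.
pose cnt x y := count (fun b => (x \in b) && (y \in b)) (blocks base).
have cnt_sg x y : P x -> P y -> cnt (sg x) (sg y) = cnt x y.
  move=> xP yP; rewrite /cnt /blocks !count_flatten -!map_comp; congr sumn.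
  apply/eq_in_map => Lq /hb/allP h /=; rewrite !count_flatten -!map_comp; congr sumn.
  apply/eq_in_map => q /h/and4P[_ _ qP pq] /=; set t := traject _ _ _.
  pose c (b : seq T) := (sg x \in b) && (sg y \in b).
  (* Applying [sg] to an orbit drops its first block and appends the [Lq.1]-th image, which is the
     first block up to order. *)
  have ct : c q + count c (map (map sg) t) = count c t + c (iter Lq.1 (map sg) q).
    transitivity (count c (traject (map sg) q Lq.1.+1)).
      by rewrite trajectS /t; congr (_ + count c _); elim: (Lq.1) q {qP pq t} => //= n IHn q; rewrite IHn.
    by rewrite trajectSr -cats1 count_cat /= addn0.
  have cq : c (iter Lq.1 (map sg) q) = c q by rewrite /c !(perm_mem pq).
  move: ct; rewrite cq addnC => /addIn <-; rewrite count_map.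
  by apply: eq_in_count => b /(allP (PT _ _ qP)) bP; rewrite /c /= !Pmem.
have cnt_orbit o y : o \in orbits -> y != o.2 -> cnt o.2 y = P y && R o.2 y.
  move=> /ho/eqP e yo; have /(congr1 (count_mem y)) := e.
  rewrite [RHS](count_uniq_mem _ (filter_uniq _ upts)) mem_filter ptsP andbC => <-.
  rewrite (permP (permEl (perm_sort _ _))) count_flatten -map_comp sumnE big_map big_filter.
  rewrite /cnt -sum1_count big_mkcondr /= big_seq_cond [RHS]big_seq_cond.
  apply: eq_bigr => b /andP[/blockP/and3P[ub _ _] ob].
  by rewrite (count_uniq_mem _ (rem_uniq _ ub)) (mem_rem_uniq _ ub) !inE yo; case: ifP.
exists (blocks base); split=> [b /blockP/and3P[-> /eqP-> _]//|x y xy]; rewrite -/(cnt x y).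
have [/andP[xP yP]|nP] := boolP (P x && P y); last first.
  rewrite (_ : [&& _, _ & _] = false); last by rewrite andbA (negPf nP).
  apply/eqP; rewrite eqn0Ngt -has_count; apply/negP => /hasP[b /blockP/and3P[_ _ /allP bP]].
  by case/andP=> /bP xP /bP yP; rewrite xP yP in nP.
(* Write [x] as the image of an orbit representative under a power of [sg], and pull [y] back by the
   same power. *)
have /flattenP[_ /mapP[o oO ->] /trajectP[i io ex]] : x \in flatten [seq traject sg o.2 o.1 | o <- orbits].
  by rewrite -(mem_sort le) e2 ptsP.
have oP : P o.2.
  rewrite -ptsP -e2 mem_sort; apply/flattenP; exists (traject sg o.2 o.1); first exact: map_f.
  by apply/trajectP; exists 0 => //; apply: leq_ltn_trans io.
have Psgi j z : P z -> P (iter j sg z) by move=> zP; elim: j => //= j; apply: Psg.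
have [z zP ey] : exists2 z, P z & y = iter i sg z.
  elim: (i) y yP {xy} => [|j IHj] y yP; first by exists y.
  have : y \in map sg pts by rewrite -(perm_mem perm_sg) ptsP.
  by case/mapP=> y'; rewrite ptsP => /IHj[z zP ->] ->; exists z.
rewrite xP yP ex ey; have zo : z != o.2 by apply: contra_neq xy; rewrite ex ey => ->.
transitivity (R o.2 z : nat); last by elim: (i) => //= j ->; rewrite invR ?Psgi.
by rewrite -[R _ _]/(true && _) -{1}zP -cnt_orbit //; elim: (i) => //= j <-; rewrite cnt_sg ?Psgi.
Qed.

End Orbits.

(* Vertices are pairs (group, position): [gm w k x] is the complete multipartite graph with
   groups 0, ..., k-1 of size [w] and a group [k] of size [x]. *)
Definition gsize w k x c := if c < k then w else if c == k then x else 0.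
Definition gm w k x : rel (nat * nat) := fun p q =>
  [&& p.1 != q.1, p.2 < gsize w k x p.1 & q.2 < gsize w k x q.1].

(* The tensor product of complete graphs on [u] and [k] vertices. *)
Definition mg k u : rel (nat * nat) := fun p q =>
  [&& p.1 != q.1, p.2 != q.2, (p.1 < u) && (q.1 < u) & (p.2 < k) && (q.2 < k)].

Section Codes.
Local Open Scope N_scope.

(* The permutation whose cycles are intervals with successive lengths [l]. *)
Fixpoint rot (l : seq N) (p : N) : N :=
  if l is c :: l' then
    if p <? c then (if p + 1 =? c then 0 else p + 1) else c + rot l' (p - c)
  else p.

Fixpoint starts (l : seq N) (s : N) : seq (N * N) :=
  if l is c :: l' then (c, s) :: starts l' (s + c) else [::].

Definition points (V : nat) := [seq N.of_nat i | i <- iota 0 V].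
Definition lexle (z t : N * N) := (z.1 <? t.1) || ((z.1 =? t.1) && (z.2 <=? t.2)).
Definition quad (q : N * N * N * N) := let: (a, b, c, d) := q in [:: a; b; c; d].

Definition gmlab (w k p : N) := if p <? w * k then p / w else k.

(* The vertices of [gm w k x] are numbered group by group. *)
Definition check_gm (w k x : nat) (cyc : seq N) (base : seq (nat * seq (N * N * N * N))) :=
  let: lab := gmlab (N.of_nat w) (N.of_nat k) in
  let: sg := rot cyc in
  [&& check sg N.leb (points (w * k + x)) (fun p => p <? N.of_nat (w * k + x))
        (fun p q => ~~ (lab p =? lab q)) [seq (N.to_nat c.1, c.2) | c <- starts cyc 0]
        [seq (Lq.1, map quad Lq.2) | Lq <- base],
      all (fun p => lab (sg p) =? lab (sg (lab p * N.of_nat w))) (points (w * k + x))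
    & uniq [seq lab (sg (c * N.of_nat w)) | c <- points k.+1]].

(* The vertex [(c, i)] of [mg k u] is represented by [(i, c)], and by [i * u + c] in [base]. *)
Definition check_mg (k u : nat) (rc cc : seq N) (base : seq (nat * seq (N * N * N * N))) :=
  let: u' := N.of_nat u in
  [&& check (fun p => (rot rc p.1, rot cc p.2)) lexle [seq (x, y) | x <- points k, y <- points u]
        (fun p => (p.1 <? N.of_nat k) && (p.2 <? u'))
        (fun p q => ~~ (p.1 =? q.1) && ~~ (p.2 =? q.2))
        (flatten [seq [seq (N.to_nat (N.lcm ab.1.1 ab.2.1), (ab.1.2, ab.2.2 + t))
            | t <- points (N.to_nat (N.gcd ab.1.1 ab.2.1))]
          | ab <- [seq (a, b) | a <- starts rc 0, b <- starts cc 0]])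
        [seq (Lq.1, [seq [seq (p / u', p mod u') | p <- quad q] | q <- Lq.2]) | Lq <- base],
      uniq [seq rot rc x | x <- points k] & uniq [seq rot cc x | x <- points u]].

Lemma ltbE a b : (a <? N.of_nat b) = (N.to_nat a < b)%nat.
Proof. by apply/idP/idP => [/N.ltb_lt|?]; [lia | apply/N.ltb_lt; lia]. Qed.

Lemma eqbE a b : (a =? b) = (a == b).
Proof. by []. Qed.

Lemma to_nat_eq a b : (N.to_nat a == N.to_nat b) = (a == b).
Proof. exact: (inj_eq Nnat.N2Nat.inj). Qed.

Lemma mem_points V x : (x \in points V) = (x <? N.of_nat V).
Proof.
apply/mapP/idP => [[i + ->]|/N.ltb_lt xV]; first by rewrite mem_iota => iV; apply/N.ltb_lt; lia.
by exists (N.to_nat x); rewrite ?mem_iota ?Nnat.N2Nat.id //=; lia.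
Qed.

Lemma uniq_points V : uniq (points V).
Proof. by rewrite map_inj_uniq ?iota_uniq //; apply: Nnat.Nat2N.inj. Qed.

Lemma to_nat_divmod p (k : nat) : (0 < k)%nat ->
  N.to_nat (p / N.of_nat k) = (N.to_nat p %/ k)%nat /\
  N.to_nat (p mod N.of_nat k) = (N.to_nat p %% k)%nat.
Proof.
move=> k0; have ne : N.of_nat k <> 0 by lia.
have := N.div_mod p _ ne; have := N.mod_lt p _ ne.
set q := p / _; set r := p mod _ => rk ep.
have -> : N.to_nat p = (N.to_nat q * k + N.to_nat r)%nat by rewrite ep; nia.
have rk' : (N.to_nat r < k)%nat by lia.
by rewrite divnMDl // divn_small // addn0 modnMDl modn_small.
Qed.
End Codes.

Lemma check_mg_dec k u rc cc base : check_mg k u rc cc base -> dec (mg k u).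
Proof.
case/and3P=> /check_dec h /uniq_map_inj hr /uniq_map_inj hc.
pose P (p : N * N) := (N.ltb p.1 (N.of_nat k)) && (N.ltb p.2 (N.of_nat u)).
pose R (p q : N * N) := ~~ (N.eqb p.1 q.1) && ~~ (N.eqb p.2 q.2).
have PE p : P p = (N.to_nat p.1 < k) && (N.to_nat p.2 < u).
  by rewrite /P !ltbE.
have {h} : dec (fun p q => [&& P p, P q & R p q]).
  apply: h => [|[a b]|[a b] [c d]]; first by rewrite allpairs_uniq ?uniq_points //; case=> ? ? [? ?].
    rewrite -!mem_points; apply/allpairsP/andP => [[[x y] /= [? ? [-> ->]]] //|[? ?]].
    by exists (a, b).
  rewrite -!mem_points /= => /andP[ak bu] /andP[ck du].
  by congr (~~ _ && ~~ _); rewrite !eqbE; apply/eqP/eqP => [|->] //; [apply: hr|apply: hc].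
apply: (kdec_map (S := P) (f := fun p => (N.to_nat p.2, N.to_nat p.1))).
- by move=> [a b] [c d] _ _ [/Nnat.N2Nat.inj-> /Nnat.N2Nat.inj->].
- by move=> a b _ /and3P[].
- move=> [a b] [c d] aS bS _; rewrite aS bS /mg /R /= !to_nat_eq.
  by move: aS bS; rewrite !PE /= => /andP[-> ->] /andP[-> ->]; rewrite andbC !andbT.
- move=> [a b] [c d] _ /and4P[/= _ _ /andP[au cu] /andP[bk dk]].
  exists (N.of_nat b, N.of_nat a), (N.of_nat d, N.of_nat c).
  by rewrite !PE /= !Nnat.Nat2N.id au bk cu dk.
Qed.

Lemma check_gm_dec w k x cyc base : check_gm w k x cyc base -> 0 < w -> dec (gm w k x).
Proof.
case/and3P=> /check_dec h /allP hl /uniq_map_inj hu w0.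
pose lab := gmlab (N.of_nat w) (N.of_nat k).
pose S p := N.ltb p (N.of_nat (w * k + x)); pose R p q := ~~ N.eqb (lab p) (lab q).
pose f p := if N.to_nat p < w * k then (N.to_nat p %/ w, N.to_nat p %% w)
  else (k, N.to_nat p - w * k).
have inS p : S p = (N.to_nat p < w * k + x) by rewrite /S ltbE.
have ltwk p : N.ltb p (N.of_nat w * N.of_nat k)%num = (N.to_nat p < w * k).
  by rewrite -Nnat.Nat2N.inj_mul ltbE.
have flab p : (f p).1 = N.to_nat (lab p).
  rewrite /f /lab /gmlab ltwk; case: ifP => _ /=; last by rewrite Nnat.Nat2N.id.
  by have [-> _] := to_nat_divmod p w0.
have fS p : S p -> (f p).2 < gsize w k x (f p).1.
  rewrite inS /f /gsize; case: ifP => /= pw pS; last by rewrite ltnn eqxx; lia.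
  by rewrite ltn_divLR // [k * w]mulnC pw ltn_mod.
have lab_k p : lab p \in points k.+1.
  rewrite mem_points ltbE -flab /f; case: ifP => //= pw.
  by rewrite ltnS ltnW // ltn_divLR // mulnC.
have {h} : dec (fun p q => [&& S p, S q & R p q]).
  apply: h => [||a b]; rewrite -?mem_points; [exact: uniq_points|exact: mem_points|].
  (* The label check says that the part of [sg p] depends only on the part of [p], the [uniq] check
     that distinct parts have distinct images. Together they give the invariance of [R] under
     [sg]. *)
  move=> aP bP; congr (~~ _); rewrite !eqbE; apply/eqP/eqP.
    by move: (hl _ aP) (hl _ bP) => /N.eqb_eq-> /N.eqb_eq->; apply: hu; apply: lab_k.
  move=> e; move: (hl _ aP) (hl _ bP) => /N.eqb_eq-> /N.eqb_eq->.
  by congr (lab (rot _ (_ * _)%num)).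
apply: (kdec_map (S := S) (f := f)).
- move=> a b _ _; rewrite /f; case: ifP => aw; case: ifP => bw [].
  + by move=> ed em; apply: Nnat.N2Nat.inj; rewrite (divn_eq (N.to_nat a) w) em ed -divn_eq.
  + by move=> ek; have : N.to_nat a %/ w < k by [rewrite ltn_divLR // mulnC]; rewrite ek ltnn.
  + by move=> ek; have : N.to_nat b %/ w < k by [rewrite ltn_divLR // mulnC]; rewrite -ek ltnn.
  + by move=> ed; apply: Nnat.N2Nat.inj; lia.
- by move=> a b _ /and3P[].
- by move=> a b aS bS ab; rewrite /R aS bS /gm !fS //= !andbT !flab to_nat_eq.
- move=> [a b] [c d] _ /and3P[/= _ ba dc].
  have E i j : j < gsize w k x i -> exists p, S p /\ (i, j) = f p.
    rewrite /gsize; case: ifP => [ik jw|ik].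
      exists (N.of_nat (i * w + j)).
      have jik : i * w + j < w * k.
        rewrite [w * k]mulnC; apply: leq_trans (_ : i.+1 * w <= _); first by rewrite mulSn; lia.
        by rewrite leq_mul2r ik orbT.
      rewrite inS /f Nnat.Nat2N.id jik modnMDl modn_small // divnMDl // divn_small // addn0.
      by split=> //; lia.
    case: eqP => // -> jx; exists (N.of_nat (w * k + j)).
    rewrite inS /f Nnat.Nat2N.id; case: ifP => [|_]; first by lia.
    by split; [lia | congr pair; lia].
  by have [p [pS ->]] := E _ _ ba; have [q [qS ->]] := E _ _ dc; exists p, q.
Qed.

(* Found by computer search.  An entry of [gm_designs] consists of the parameters, the cycle lengths of
   an automorphism and base blocks with the lengths of their orbits; in [mg_designs] the automorphism
   is a product of one on the [k] rows and one on the [u] columns. *)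
Section Designs.
Local Open Scope N_scope.

Definition gm_designs : seq (nat * nat * nat * seq N * seq (nat * seq (N * N * N * N))) := [::
  ((1, 9, 4)%nat, [:: 8; 1; 4],
   [:: (4%nat, [:: (0,4,8,10)]); (8%nat, [:: (0,1,6,9)])]);
  ((1, 12, 1)%nat, [:: 3; 3; 3; 3; 1],
   [:: (3%nat, [:: (3,7,10,12); (0,4,5,10); (0,3,6,8); (0,7,9,11)]); (1%nat, [:: (0,1,2,12)])]);
  ((1, 12, 4)%nat, [:: 6; 6; 2; 2],
   [:: (3%nat, [:: (0,3,6,9)]); (2%nat, [:: (6,8,10,15); (0,2,4,13)]); (6%nat, [:: (0,1,8,14);
    (0,10,11,12)])]);
  ((1, 15, 1)%nat, [:: 15; 1],
   [:: (5%nat, [:: (0,5,10,15)]); (15%nat, [:: (0,1,9,13)])]);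
  ((1, 15, 7)%nat, [:: 7; 7; 1; 7],
   [:: (7%nat, [:: (0,13,14,15); (0,1,11,18); (0,2,9,21); (0,3,8,16); (7,8,12,18)])]);
  ((1, 21, 4)%nat, [:: 21; 3; 1],
   [:: (7%nat, [:: (0,7,14,24)]); (21%nat, [:: (0,2,13,21); (0,1,4,16)])]);
  ((1, 21, 10)%nat, [:: 7; 7; 7; 7; 1; 1; 1],
   [:: (7%nat, [:: (0,9,16,28); (0,8,17,29); (0,12,15,30); (7,8,10,26); (0,11,19,25); (0,10,14,23);
    (0,13,18,21); (0,1,5,27); (0,7,20,24); (14,15,17,22)])]);
  ((1, 24, 1)%nat, [:: 12; 12; 1],
   [:: (4%nat, [:: (0,4,8,24); (12,16,20,24)]); (6%nat, [:: (0,6,13,19)]); (12%nat, [:: (0,1,17,22);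
    (0,2,5,20); (0,12,14,23)])]);
  ((1, 24, 4)%nat, [:: 24; 4],
   [:: (6%nat, [:: (0,6,12,18)]); (24%nat, [:: (0,2,17,21); (0,1,14,26)]); (8%nat, [:: (0,8,16,27)])]);
  ((1, 24, 7)%nat, [:: 6; 6; 6; 6; 6; 1],
   [:: (3%nat, [:: (6,9,18,21); (0,3,13,16)]); (6%nat, [:: (6,14,20,30); (6,12,13,24); (12,14,23,28);
    (0,14,18,22); (0,10,11,15); (0,1,12,27); (6,15,22,28); (0,6,23,25); (0,7,9,24); (0,19,20,29);
    (0,8,21,28)]); (2%nat, [:: (0,2,4,30)])]);
  ((1, 24, 10)%nat, [:: 12; 12; 3; 3; 3; 1],
   [:: (4%nat, [:: (0,4,8,33); (12,16,20,33)]); (3%nat, [:: (12,15,18,21); (0,3,6,9)]); (12%nat, [::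
    (0,2,13,24); (0,17,22,26); (0,5,12,30); (0,16,18,32); (0,20,21,27); (0,1,15,29)])]);
  ((1, 27, 1)%nat, [:: 9; 9; 9; 1],
   [:: (9%nat, [:: (0,16,19,27); (9,10,18,23); (0,22,23,25); (0,9,13,24); (0,4,10,12); (0,1,7,18);
    (0,11,14,21)])]);
  ((1, 27, 7)%nat, [:: 9; 9; 9; 3; 1; 1; 1; 1],
   [:: (9%nat, [:: (0,17,21,31); (0,12,20,33); (0,13,19,30); (0,9,23,32); (9,10,16,19); (0,22,24,25);
    (9,20,25,27); (0,1,18,27); (0,11,15,28); (0,2,6,16)])]);
  ((1, 27, 13)%nat, [:: 26; 1; 13],
   [:: (13%nat, [:: (0,13,26,29)]); (26%nat, [:: (0,4,18,31); (0,1,11,34); (0,3,9,28); (0,2,7,37)])]);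
  ((1, 33, 4)%nat, [:: 33; 3; 1],
   [:: (11%nat, [:: (0,11,22,36)]); (33%nat, [:: (0,1,29,35); (0,3,17,26); (0,2,15,27)])]);
  ((1, 33, 10)%nat, [:: 4; 4; 4; 4; 4; 4; 4; 4; 1; 4; 2; 2; 2],
   [:: (2%nat, [:: (20,22,32,42); (12,14,32,39); (0,2,32,38); (8,10,24,26); (16,18,28,30)]); (1%nat, [::
    (4,5,6,7)]); (4%nat, [:: (4,9,28,32); (16,25,32,33); (0,21,31,42); (12,19,30,42); (0,8,11,41);
    (4,19,27,41); (4,15,25,42); (8,20,29,39); (8,17,27,40); (0,7,29,40); (4,22,26,40); (0,15,17,39);
    (24,28,31,37); (12,23,24,25); (0,24,30,35); (0,6,26,36); (0,14,18,25); (0,10,27,37); (20,27,28,36);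
    (0,5,19,28); (0,1,13,34); (0,4,16,20); (0,9,22,23); (8,12,15,28); (4,11,29,35); (12,20,31,34);
    (4,10,17,33); (8,13,18,33); (4,13,23,36); (4,8,14,38); (4,12,21,37); (8,16,23,34); (16,17,22,37)])]);
  ((1, 33, 16)%nat, [:: 32; 1; 16],
   [:: (16%nat, [:: (0,16,32,47)]); (32%nat, [:: (0,7,22,45); (0,1,14,34); (0,9,21,46); (0,2,28,44);
    (0,3,8,43)])]);
  ((1, 36, 1)%nat, [:: 18; 18; 1],
   [:: (6%nat, [:: (0,6,12,36); (18,24,30,36)]); (9%nat, [:: (0,9,23,32)]); (18%nat, [:: (0,2,13,22);
    (0,8,19,21); (0,1,15,25); (0,18,26,33); (0,30,34,35)])]);
  ((1, 36, 4)%nat, [:: 18; 18; 3; 1],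
   [:: (6%nat, [:: (0,6,12,39); (18,24,30,39)]); (9%nat, [:: (0,9,18,27)]); (18%nat, [:: (0,2,22,38);
    (0,25,29,37); (0,26,33,34); (0,30,32,35); (0,1,5,24); (0,3,10,31)])]);
  ((1, 36, 7)%nat, [:: 18; 18; 6; 1],
   [:: (6%nat, [:: (18,24,30,42); (0,6,12,42)]); (9%nat, [:: (0,9,18,27)]); (18%nat, [:: (0,8,30,34);
    (0,7,20,41); (0,1,3,39); (0,5,28,29); (0,4,19,21); (0,25,32,37); (18,21,26,40)])]);
  ((1, 36, 10)%nat, [:: 18; 18; 3; 3; 3; 1],
   [:: (6%nat, [:: (0,6,12,45); (18,24,30,45)]); (9%nat, [:: (0,9,22,31)]); (18%nat, [:: (0,8,32,35);
    (0,3,26,28); (0,7,18,44); (0,20,33,42); (0,2,21,39); (0,30,34,41); (18,19,29,37); (0,1,5,36)])]);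
  ((1, 36, 13)%nat, [:: 18; 18; 6; 6; 1],
   [:: (6%nat, [:: (18,24,30,48); (0,6,12,48)]); (9%nat, [:: (0,9,19,28)]); (18%nat, [:: (0,21,22,39);
    (0,2,34,37); (0,4,29,36); (0,18,26,40); (0,1,24,45); (0,3,10,46); (0,5,20,35); (0,27,31,47);
    (18,20,25,43)])]);
  ((1, 36, 16)%nat, [:: 12; 12; 12; 12; 2; 1; 1],
   [:: (6%nat, [:: (12,18,27,33)]); (3%nat, [:: (0,3,6,9)]); (12%nat, [:: (0,14,27,51); (0,19,25,50);
    (12,15,26,49); (0,1,29,49); (0,21,23,37); (12,13,17,42); (0,17,24,41); (0,15,32,36); (0,2,18,45);
    (0,12,34,47); (0,5,13,44); (0,22,30,42); (12,24,28,46); (0,4,35,38); (0,26,33,40); (24,25,34,45)])]);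
  ((1, 39, 1)%nat, [:: 39; 1],
   [:: (13%nat, [:: (0,13,26,39)]); (39%nat, [:: (0,1,9,34); (0,2,18,29); (0,3,7,22)])]);
  ((1, 39, 7)%nat, [:: 39; 3; 3; 1],
   [:: (13%nat, [:: (0,13,26,45)]); (39%nat, [:: (0,8,28,44); (0,4,29,40); (0,2,9,36); (0,1,16,22)])]);
  ((1, 39, 13)%nat, [:: 39; 13],
   [:: (13%nat, [:: (0,13,26,43)]); (39%nat, [:: (0,2,24,49); (0,5,16,40); (0,8,20,39); (0,4,18,46);
    (0,1,30,33)])]);
  ((1, 39, 19)%nat, [:: 19; 19; 1; 19],
   [:: (19%nat, [:: (0,37,38,44); (0,7,22,45); (0,21,31,39); (0,32,33,48); (0,24,36,55); (0,25,30,54);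
    (0,20,35,41); (0,8,27,40); (19,21,27,49); (0,26,29,46); (0,5,28,42); (0,4,13,47); (0,1,17,50)])]);
  ((1, 45, 4)%nat, [:: 45; 3; 1],
   [:: (15%nat, [:: (0,15,30,48)]); (45%nat, [:: (0,2,16,47); (0,1,19,24); (0,3,12,37); (0,4,32,39)])]);
  ((1, 45, 10)%nat, [:: 45; 9; 1],
   [:: (15%nat, [:: (0,15,30,54)]); (45%nat, [:: (0,1,28,34); (0,7,23,32); (0,4,35,49); (0,3,8,51);
    (0,2,26,46)])]);
  ((1, 45, 16)%nat, [:: 45; 15; 1],
   [:: (15%nat, [:: (0,15,30,60)]); (45%nat, [:: (0,11,33,57); (0,7,17,50); (0,1,5,37); (0,2,16,53);
    (0,6,25,55); (0,3,21,47)])]);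
  ((1, 45, 22)%nat, [:: 21; 21; 1; 1; 1; 21; 1],
   [:: (1%nat, [:: (42,43,44,66)]); (7%nat, [:: (21,28,35,66); (0,7,14,66)]); (21%nat, [:: (0,38,42,61);
    (0,40,44,53); (0,41,43,59); (21,22,26,47); (0,9,27,63); (21,24,36,64); (0,4,33,50); (0,23,31,60);
    (0,24,34,48); (0,35,37,47); (0,10,25,45); (0,6,32,64); (0,1,22,52); (0,2,30,57); (0,3,16,65)])]);
  ((1, 51, 1)%nat, [:: 51; 1],
   [:: (17%nat, [:: (0,17,34,51)]); (51%nat, [:: (0,7,19,37); (0,2,10,13); (0,1,5,29); (0,6,15,31)])]);
  ((1, 51, 7)%nat, [:: 51; 3; 3; 1],
   [:: (17%nat, [:: (0,17,34,57)]); (51%nat, [:: (0,2,46,55); (0,13,35,52); (0,1,25,31); (0,9,19,37);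
    (0,3,11,15)])]);
  ((1, 51, 13)%nat, [:: 51; 3; 3; 3; 3; 1],
   [:: (17%nat, [:: (0,17,34,63)]); (51%nat, [:: (0,11,25,52); (0,5,43,62); (0,1,29,56); (0,4,35,57);
    (0,2,12,44); (0,3,18,24)])]);
  ((1, 51, 19)%nat, [:: 17; 17; 17; 17; 1; 1],
   [:: (17%nat, [:: (0,19,39,69); (0,26,48,68); (0,27,29,61); (0,21,31,54); (17,23,38,54); (17,20,50,58);
    (0,20,24,43); (0,28,33,45); (17,25,43,60); (0,22,23,67); (0,32,46,51); (0,17,42,63); (0,7,25,55);
    (17,41,44,59); (0,30,41,52); (0,36,40,66); (0,38,44,58); (34,36,44,63); (0,2,37,49); (0,34,50,57);
    (0,3,11,56); (0,1,13,60)])]);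
  ((1, 51, 25)%nat, [:: 50; 1; 25],
   [:: (25%nat, [:: (0,25,50,60)]); (50%nat, [:: (0,2,23,66); (0,8,28,65); (0,3,44,75); (0,15,33,61);
    (0,1,13,55); (0,7,26,52); (0,5,16,74); (0,4,40,63)])]);
  ((1, 57, 4)%nat, [:: 57; 3; 1],
   [:: (19%nat, [:: (0,19,38,60)]); (57%nat, [:: (0,5,16,58); (0,1,35,44); (0,2,32,42); (0,6,18,26);
    (0,3,24,53)])]);
  ((1, 57, 10)%nat, [:: 57; 3; 3; 3; 1],
   [:: (19%nat, [:: (0,19,38,66)]); (57%nat, [:: (0,11,43,58); (0,7,44,60); (0,4,35,65); (0,1,9,30);
    (0,2,5,47); (0,6,23,39)])]);
  ((1, 57, 16)%nat, [:: 57; 3; 3; 3; 3; 3; 1],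
   [:: (19%nat, [:: (0,19,38,72)]); (57%nat, [:: (0,13,29,69); (0,1,53,62); (0,7,17,67); (0,8,22,58);
    (0,2,25,64); (0,6,15,26); (0,3,21,33)])]);
  ((1, 57, 22)%nat, [:: 19; 19; 19; 19; 1; 1; 1],
   [:: (19%nat, [:: (0,22,45,78); (0,33,39,77); (0,23,47,76); (0,27,34,73); (0,30,48,63); (19,21,34,66);
    (0,5,21,31); (19,22,48,72); (0,25,36,52); (0,32,37,62); (19,50,55,73); (19,40,49,62); (0,4,28,65);
    (19,20,53,61); (0,1,20,75); (19,39,47,59); (19,38,41,67); (0,29,42,67); (0,7,53,64); (0,54,56,70);
    (0,51,55,72); (0,43,44,50); (0,9,49,68); (0,3,41,69); (0,2,8,60)])]);
  ((1, 57, 28)%nat, [:: 56; 1; 28],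
   [:: (28%nat, [:: (0,28,56,62)]); (56%nat, [:: (0,11,26,57); (0,9,44,69); (0,1,8,71); (0,3,17,68);
    (0,5,24,80); (0,13,38,58); (0,2,22,66); (0,6,46,67); (0,4,27,82)])]);
  ((1, 63, 1)%nat, [:: 63; 1],
   [:: (21%nat, [:: (0,21,42,63)]); (63%nat, [:: (0,3,41,48); (0,2,29,59); (0,1,11,51); (0,5,37,54);
    (0,8,24,43)])]);
  ((1, 63, 7)%nat, [:: 63; 3; 3; 1],
   [:: (21%nat, [:: (0,21,42,69)]); (63%nat, [:: (0,5,22,63); (0,10,38,68); (0,1,48,50); (0,7,18,37);
    (0,4,12,36); (0,3,23,57)])]);
  ((1, 63, 13)%nat, [:: 63; 3; 3; 3; 3; 1],
   [:: (21%nat, [:: (0,21,42,75)]); (63%nat, [:: (0,5,31,64); (0,10,44,68); (0,11,46,72); (0,2,49,71);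
    (0,1,4,40); (0,6,15,56); (0,8,20,38)])]);
  ((1, 63, 19)%nat, [:: 63; 3; 3; 3; 3; 3; 3; 1],
   [:: (21%nat, [:: (0,21,42,81)]); (63%nat, [:: (0,7,20,73); (0,5,19,70); (0,2,34,67); (0,10,38,63);
    (0,1,17,79); (0,4,26,77); (0,3,11,51); (0,6,36,45)])]);
  ((1, 63, 25)%nat, [:: 21; 21; 21; 3; 3; 3; 1; 1; 1; 1; 1; 1; 1; 1; 1; 1; 1; 1; 1; 1; 1; 1],
   [:: (21%nat, [:: (0,39,45,87); (0,35,50,75); (0,30,56,81); (0,37,46,72); (0,23,42,78); (0,31,44,86);
    (0,41,57,73); (0,33,55,82); (0,27,48,74); (0,29,60,84); (0,21,59,76); (0,25,49,85); (0,40,54,77);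
    (0,32,43,80); (0,38,58,79); (0,24,47,83); (0,34,52,70); (0,22,51,71); (0,28,53,69); (0,26,36,67);
    (21,49,54,66); (0,1,62,66); (0,2,7,64); (0,3,11,15); (42,46,56,65); (42,43,45,51); (21,22,35,63);
    (21,23,27,39)])]);
  ((1, 63, 31)%nat, [:: 31; 31; 1; 31],
   [:: (31%nat, [:: (0,58,62,77); (0,2,36,71); (0,4,50,74); (0,15,57,67); (0,1,55,88); (0,38,53,80);
    (0,9,49,72); (0,41,48,66); (0,32,61,93); (0,14,39,75); (0,5,25,89); (0,7,51,85); (0,3,13,68);
    (0,12,47,91); (0,8,37,90); (0,43,52,81); (0,31,59,76); (0,33,45,73); (31,39,49,70); (31,32,58,78);
    (31,37,48,74)])]);
  ((1, 81, 4)%nat, [:: 81; 3; 1],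
   [:: (27%nat, [:: (0,27,54,84)]); (81%nat, [:: (0,13,62,82); (0,1,7,18); (0,8,43,58); (0,3,33,55);
    (0,2,47,71); (0,5,14,42); (0,4,25,65)])]);
  ((1, 81, 10)%nat, [:: 81; 3; 3; 3; 1],
   [:: (27%nat, [:: (0,27,54,90)]); (81%nat, [:: (0,19,44,84); (0,11,64,82); (0,5,40,87); (0,3,69,77);
    (0,13,34,52); (0,1,10,33); (0,6,30,61); (0,2,45,67)])]);
  ((1, 81, 16)%nat, [:: 81; 3; 3; 3; 3; 3; 1],
   [:: (27%nat, [:: (0,27,54,96)]); (81%nat, [:: (0,8,43,89); (0,11,28,95); (0,23,55,82); (0,7,41,85);
    (0,5,61,92); (0,9,19,48); (0,2,6,65); (0,3,24,69); (0,1,14,51)])]);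
  ((1, 81, 22)%nat, [:: 81; 3; 3; 3; 3; 3; 3; 3; 1],
   [:: (27%nat, [:: (0,27,54,102)]); (81%nat, [:: (0,11,37,100); (0,13,56,88); (0,4,65,86); (0,2,31,98);
    (0,5,19,81); (0,10,59,90); (0,1,35,95); (0,7,28,73); (0,6,23,63); (0,3,12,51)])]);
  ((1, 81, 28)%nat, [:: 81; 9; 9; 9; 1],
   [:: (27%nat, [:: (0,27,54,108)]); (81%nat, [:: (0,1,31,99); (0,5,28,106); (0,21,55,103); (0,6,25,43);
    (0,3,39,72); (0,8,49,90); (0,10,67,97); (0,7,66,92); (0,4,65,89); (0,17,46,83); (0,2,13,81)])]);
  ((1, 81, 34)%nat, [:: 27; 27; 27; 27; 3; 3; 1],
   [:: (27%nat, [:: (0,41,71,114); (0,47,52,113); (27,62,79,113); (0,7,80,112); (27,29,73,109);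
    (0,40,77,109); (0,13,74,108); (0,34,62,91); (0,9,79,93); (0,56,76,92); (27,30,77,102); (27,69,80,107);
    (0,43,55,106); (27,59,65,98); (0,58,66,81); (54,55,77,99); (0,37,64,78); (0,32,63,65); (0,69,72,100);
    (27,61,76,95); (0,59,68,94); (0,3,57,89); (27,38,56,104); (0,8,75,95); (27,35,75,105); (27,34,70,83);
    (0,36,60,97); (0,27,39,101); (0,2,53,85); (27,28,45,82); (0,4,49,107); (0,1,6,105); (0,29,50,96);
    (0,12,33,102); (0,10,38,98); (0,11,42,46); (0,30,44,82)])]);
  ((1, 81, 40)%nat, [:: 80; 1; 40],
   [:: (40%nat, [:: (0,40,80,118)]); (80%nat, [:: (0,9,30,93); (0,14,48,104); (0,1,73,92); (0,10,25,119);
    (0,2,76,82); (0,11,68,117); (0,3,56,113); (0,17,60,88); (0,13,41,115); (0,19,45,100); (0,5,36,112);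
    (0,18,47,105); (0,16,58,101)])]);
  ((1, 87, 1)%nat, [:: 87; 1],
   [:: (29%nat, [:: (0,29,58,87)]); (87%nat, [:: (0,4,64,76); (0,2,28,68); (0,14,34,65); (0,1,8,18);
    (0,3,16,48); (0,6,43,52); (0,5,38,62)])]);
  ((1, 87, 7)%nat, [:: 87; 3; 3; 1],
   [:: (29%nat, [:: (0,29,58,93)]); (87%nat, [:: (0,10,56,89); (0,2,34,91); (0,6,15,75); (0,1,14,21);
    (0,4,49,54); (0,11,30,47); (0,8,43,71); (0,3,25,64)])]);
  ((1, 87, 13)%nat, [:: 87; 3; 3; 3; 3; 1],
   [:: (29%nat, [:: (0,29,58,99)]); (87%nat, [:: (0,14,64,92); (0,4,17,97); (0,5,16,88); (0,20,55,95);
    (0,1,7,49); (0,9,60,72); (0,8,34,77); (0,2,56,59); (0,19,40,65)])]);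
  ((1, 87, 19)%nat, [:: 87; 3; 3; 3; 3; 3; 3; 1],
   [:: (29%nat, [:: (0,29,58,105)]); (87%nat, [:: (0,17,40,94); (0,2,46,90); (0,4,53,88); (0,7,20,98);
    (0,5,37,99); (0,10,35,103); (0,1,61,69); (0,6,15,71); (0,3,48,76); (0,12,33,63)])]);
  ((1, 87, 25)%nat, [:: 29; 29; 29; 1; 1; 1; 1; 1; 1; 1; 1; 1; 1; 1; 1; 1; 1; 1; 1; 1; 1; 1; 1; 1; 1; 1; 1;
    1],
   [:: (29%nat, [:: (0,45,79,106); (0,34,73,101); (0,50,71,104); (0,38,74,88); (0,32,64,103); (0,52,70,91);
    (0,55,61,89); (0,48,77,92); (0,41,84,97); (0,36,82,87); (0,47,78,102); (0,57,68,100); (0,33,75,94);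
    (0,49,76,98); (0,44,63,110); (0,54,69,99); (0,35,80,96); (0,46,72,105); (0,29,83,109); (0,53,62,111);
    (0,37,65,90); (0,30,67,108); (0,51,81,93); (0,40,60,95); (0,42,66,107); (0,2,58,59); (29,40,62,81);
    (0,4,31,43); (0,3,18,24); (0,1,13,20); (29,30,49,55); (29,31,36,44); (58,60,64,71); (58,61,66,75)])]);
  ((1, 87, 31)%nat, [:: 29; 29; 29; 29; 1; 1],
   [:: (29%nat, [:: (0,47,82,116); (0,56,65,117); (29,43,84,113); (0,45,85,93); (0,7,33,114); (0,12,48,101);
    (0,53,68,100); (0,34,35,113); (29,75,79,90); (0,41,75,109); (0,30,39,96); (0,11,57,99); (29,60,68,88);
    (0,40,69,104); (29,32,77,83); (29,31,39,104); (0,31,38,42); (29,42,85,87); (0,37,54,74); (29,34,76,114);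
    (0,49,77,87); (0,29,52,112); (0,1,44,106); (0,32,62,95); (29,65,82,101); (0,50,73,90); (0,51,83,84);
    (0,66,71,92); (0,4,80,98); (0,61,79,103); (0,5,64,91); (0,2,8,110); (0,9,58,72); (0,14,81,111);
    (58,60,80,103); (58,61,71,112); (0,3,19,60)])]);
  ((1, 87, 37)%nat, [:: 37; 37; 1; 1; 1; 1; 1; 1; 1; 1; 1; 1; 1; 1; 1; 37],
   [:: (37%nat, [:: (0,1,73,112); (0,2,8,105); (0,3,69,93); (0,4,28,99); (0,5,17,68); (0,7,44,98);
    (0,10,26,104); (0,14,38,87); (0,15,71,100); (0,18,40,120); (0,39,60,123); (0,41,79,89); (0,42,46,70);
    (0,43,84,118); (0,45,74,116); (0,47,85,114); (0,48,67,88); (0,49,80,121); (0,50,53,106); (0,52,78,107);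
    (0,54,77,113); (0,55,75,96); (0,57,81,117); (0,58,76,109); (0,62,83,119); (0,64,86,92); (0,65,82,101);
    (37,38,52,120); (37,39,47,89); (37,42,49,111); (37,43,63,107)]); (1%nat, [:: (74,75,83,86);
    (74,76,79,85); (74,77,78,81); (74,80,82,84); (75,76,78,84); (75,77,79,82); (75,80,81,85); (76,77,80,86);
    (76,81,82,83); (77,83,84,85); (78,79,80,83); (78,82,85,86); (79,81,84,86)])]);
  ((1, 87, 43)%nat, [:: 43; 43; 1; 43],
   [:: (43%nat, [:: (0,53,86,116); (0,6,81,102); (0,4,11,110); (0,46,82,124); (0,3,22,94); (0,14,69,114);
    (0,68,78,122); (0,8,28,112); (0,13,57,118); (0,49,63,128); (0,5,47,87); (0,1,52,90); (0,64,66,98);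
    (0,12,83,92); (0,58,67,108); (0,72,73,97); (0,17,77,126); (0,10,84,113); (0,65,76,88); (0,18,54,111);
    (0,9,70,129); (0,16,59,117); (0,2,50,121); (0,56,62,95); (0,45,80,107); (43,46,62,99); (43,48,63,94);
    (43,55,73,103); (43,47,64,90)])]);
  ((1, 84, 1)%nat, [:: 42; 42; 1],
   [:: (14%nat, [:: (42,56,70,84); (0,14,28,84)]); (21%nat, [:: (0,21,61,82)]); (42%nat, [:: (0,47,49,74);
    (0,8,53,71); (0,12,50,55); (0,65,66,76); (0,48,52,60); (0,42,68,77); (0,56,59,78); (0,15,73,79);
    (0,10,54,67); (0,2,11,83); (0,6,13,75); (0,5,23,51); (0,1,17,39)])]);
  ((1, 99, 1)%nat, [:: 99; 1],
   [:: (33%nat, [:: (0,33,66,99)]); (99%nat, [:: (0,11,42,85); (0,4,44,65); (0,1,76,84); (0,5,27,37);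
    (0,3,53,82); (0,6,18,69); (0,2,47,60); (0,7,26,35)])]);
  ((1, 147, 1)%nat, [:: 147; 1],
   [:: (49%nat, [:: (0,49,98,147)]); (147%nat, [:: (0,3,32,124); (0,1,17,107); (0,21,69,100); (0,9,84,112);
    (0,10,76,87); (0,4,50,93); (0,12,85,123); (0,6,45,65); (0,2,134,142); (0,14,33,51); (0,25,67,120);
    (0,22,83,113)])]);
  ((3, 4, 0)%nat, [:: 2; 1; 2; 1; 2; 1; 2; 1],
   [:: (1%nat, [:: (2,5,8,11)]); (2%nat, [:: (0,4,8,9); (2,3,6,9); (0,3,7,11); (0,5,6,10)])]);
  ((3, 4, 3)%nat, [:: 3; 3; 3; 3; 3],
   [:: (3%nat, [:: (0,7,11,12); (0,5,8,14); (3,7,9,14); (0,4,6,9); (0,3,10,13)])]);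
  ((3, 5, 6)%nat, [:: 1; 1; 1; 1; 1; 1; 1; 1; 1; 1; 1; 1; 1; 1; 1; 1; 1; 1; 1; 1; 1],
   [:: (1%nat, [:: (3,11,12,19); (1,7,10,19); (2,8,14,19); (4,9,13,19); (0,5,6,19); (0,3,10,20);
    (5,10,14,16); (2,10,13,17); (8,10,12,18); (4,6,10,15); (0,4,8,17); (0,7,12,16); (2,4,11,16);
    (1,4,12,20); (4,7,14,18); (0,9,14,15); (0,11,13,18); (2,5,12,15); (6,11,14,20); (1,8,11,15);
    (1,3,14,17); (3,7,13,15); (5,7,11,17); (2,7,9,20); (3,8,9,16); (1,5,9,18); (1,6,13,16); (5,8,13,20);
    (2,3,6,18); (6,9,12,17)])]);
  ((6, 4, 6)%nat, [:: 6; 6; 6; 6; 3; 3],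
   [:: (6%nat, [:: (0,12,20,28); (0,9,16,27); (6,17,23,29); (0,7,19,29); (0,6,14,26); (0,15,22,25);
    (0,10,13,18); (6,16,19,24); (0,8,23,24); (0,11,17,21)])]);
  ((6, 4, 9)%nat, [:: 2; 2; 2; 2; 2; 2; 2; 2; 2; 2; 2; 2; 2; 1; 1; 1; 1; 1; 1; 1],
   [:: (2%nat, [:: (4,17,20,30); (6,13,22,30); (2,9,19,30); (0,10,15,30); (10,16,23,28); (2,12,20,28);
    (0,7,19,28); (4,9,15,28); (4,14,19,29); (0,11,13,29); (8,17,21,29); (2,7,22,29); (4,10,21,31);
    (4,6,16,26); (2,6,15,31); (8,12,19,31); (0,16,22,31); (10,14,18,26); (2,13,23,26); (0,8,20,26);
    (2,14,21,27); (6,14,20,24); (8,15,23,32); (0,14,23,25); (4,8,22,25); (4,11,23,27); (2,8,16,24);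
    (0,9,12,27); (0,17,18,24); (6,17,19,27); (2,11,18,25); (0,6,21,32); (4,7,13,24); (10,13,20,25);
    (4,12,18,32); (2,10,17,32)])]);
  ((18, 4, 6)%nat, [:: 18; 18; 18; 18; 3; 3],
   [:: (18%nat, [:: (0,20,45,60); (0,24,36,55); (0,31,51,56); (0,47,64,74); (0,32,42,58); (0,28,46,66);
    (0,23,49,62); (0,29,52,63); (18,40,65,75); (18,42,66,74); (0,18,39,73); (0,27,69,72); (0,33,50,68);
    (0,25,40,61); (0,26,37,59); (0,38,70,75); (0,22,41,67); (0,34,48,57); (0,35,44,54); (0,21,71,77);
    (0,19,53,65); (0,30,43,76)])]);
  ((18, 4, 9)%nat, [:: 18; 18; 18; 18; 9],
   [:: (18%nat, [:: (0,33,53,71); (18,53,61,73); (0,22,38,75); (18,40,59,72); (0,31,41,55); (0,23,68,79);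
    (0,29,44,66); (0,25,39,60); (0,30,36,69); (0,34,45,56); (0,18,37,65); (0,35,61,76); (0,27,52,59);
    (0,43,67,77); (0,19,50,70); (18,48,64,78); (0,28,46,58); (0,48,57,74); (0,47,64,80); (0,21,42,78);
    (0,26,49,62); (0,20,54,72); (0,24,51,73); (0,32,40,63)])]);
  ((30, 4, 6)%nat, [:: 30; 30; 30; 30; 3; 3],
   [:: (30%nat, [:: (0,30,76,106); (0,31,109,125); (0,32,80,114); (0,33,75,91); (0,34,64,121);
    (0,35,62,101); (0,36,89,96); (0,37,69,107); (0,38,77,95); (0,39,67,110); (0,40,84,103); (0,41,86,115);
    (0,42,68,93); (0,43,65,98); (0,44,73,97); (0,45,79,94); (0,46,83,119); (0,47,85,112); (0,48,81,116);
    (0,49,74,105); (0,50,63,104); (0,51,71,118); (0,52,87,99); (0,53,70,92); (0,54,60,113); (0,55,66,117);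
    (0,56,90,120); (0,57,88,102); (0,58,82,108); (0,59,78,124); (0,61,111,123); (0,72,100,122);
    (30,70,102,122); (30,81,91,123)])]);
  ((30, 4, 9)%nat, [:: 30; 30; 30; 30; 3; 3; 3],
   [:: (30%nat, [:: (0,30,79,109); (0,31,69,103); (0,32,73,115); (0,33,85,110); (0,34,61,97); (0,35,80,99);
    (0,36,68,107); (0,37,88,102); (0,38,86,113); (0,39,67,96); (0,40,70,127); (0,41,74,124); (0,42,66,104);
    (0,43,89,121); (0,44,78,95); (0,45,76,91); (0,46,81,94); (0,47,106,120); (0,48,62,114); (0,49,93,125);
    (0,50,90,126); (0,51,87,118); (0,52,75,108); (0,53,65,111); (0,54,71,92); (0,55,64,105); (0,56,63,117);
    (0,57,77,112); (0,58,83,101); (0,59,72,98); (0,60,100,128); (0,82,119,122); (0,84,116,123);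
    (30,70,90,128); (30,86,114,123); (30,89,112,122)])])].

Definition mg_designs : seq (nat * nat * seq N * seq N * seq (nat * seq (N * N * N * N))) := [::
  ((4, 4)%nat, [:: 2; 2], [:: 3; 1],
   [:: (6%nat, [:: (0,5,10,15); (0,7,9,14)])]);
  ((4, 5)%nat, [:: 4], [:: 5],
   [:: (20%nat, [:: (0,6,13,17)])]);
  ((4, 7)%nat, [:: 3; 1], [:: 7],
   [:: (21%nat, [:: (0,10,15,27); (0,8,19,23)])]);
  ((4, 8)%nat, [:: 2; 2], [:: 7; 1],
   [:: (14%nat, [:: (0,11,20,29); (0,9,19,30); (0,15,17,27); (0,10,22,31)])]);
  ((4, 9)%nat, [:: 4], [:: 3; 3; 3],
   [:: (12%nat, [:: (0,12,19,33); (0,10,23,31); (0,14,25,30); (3,13,25,33); (0,15,22,35); (0,11,24,34)])]);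
  ((4, 11)%nat, [:: 2; 2], [:: 11],
   [:: (22%nat, [:: (0,12,30,38); (0,13,25,41); (0,16,29,36); (0,15,32,42); (0,14,24,37)])]);
  ((4, 12)%nat, [:: 2; 2], [:: 11; 1],
   [:: (22%nat, [:: (0,14,34,45); (0,15,33,40); (0,17,32,46); (0,16,30,47); (0,23,27,43); (0,13,26,41)])]);
  ((4, 15)%nat, [:: 2; 2], [:: 15],
   [:: (30%nat, [:: (0,20,44,48); (0,21,38,46); (0,19,31,52); (0,22,36,56); (0,16,41,58); (0,18,39,53);
    (0,17,37,49)])]);
  ((4, 19)%nat, [:: 3; 1], [:: 19],
   [:: (57%nat, [:: (0,28,46,70); (0,26,42,60); (0,27,44,58); (0,21,54,65); (0,23,52,59); (0,20,51,67)])]);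
  ((4, 27)%nat, [:: 2; 2], [:: 27],
   [:: (54%nat, [:: (0,31,73,102); (0,34,77,101); (0,36,76,95); (0,29,80,90); (0,39,62,82); (0,35,64,86);
    (0,28,66,84); (0,30,75,87); (0,32,69,100); (0,37,63,89); (0,40,74,85); (0,38,60,93); (0,33,58,98)])]);
  ((7, 5)%nat, [:: 7], [:: 5],
   [:: (35%nat, [:: (0,6,14,28); (0,7,11,24)])]);
  ((7, 7)%nat, [:: 3; 3; 1], [:: 7],
   [:: (21%nat, [:: (0,25,37,47); (0,33,41,46); (0,11,30,48); (0,9,36,45); (0,8,27,31); (0,22,32,38);
    (0,10,15,39)])]);
  ((7, 8)%nat, [:: 7], [:: 4; 4],
   [:: (28%nat, [:: (0,14,25,52); (0,13,18,36); (0,30,37,47); (0,9,29,44); (0,11,41,53); (0,23,28,54);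
    (0,10,21,43)])]);
  ((7, 9)%nat, [:: 7], [:: 9],
   [:: (63%nat, [:: (0,12,29,51); (0,10,42,47); (0,11,49,55); (0,13,20,44)])]);
  ((7, 11)%nat, [:: 7], [:: 11],
   [:: (77%nat, [:: (0,12,41,46); (0,13,51,70); (0,14,40,68); (0,15,36,60); (0,17,27,69)])]);
  ((7, 12)%nat, [:: 7], [:: 11; 1],
   [:: (77%nat, [:: (0,13,53,63); (0,16,44,83); (0,22,35,65); (0,18,27,76); (0,17,37,62); (0,14,57,80)])]);
  ((7, 15)%nat, [:: 7], [:: 15],
   [:: (105%nat, [:: (0,18,41,96); (0,16,37,62); (0,19,47,61); (0,22,32,86); (0,20,71,94); (0,28,52,85);
    (0,17,53,93)])]);
  ((7, 19)%nat, [:: 7], [:: 19],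
   [:: (133%nat, [:: (0,21,92,100); (0,20,85,121); (0,23,48,91); (0,34,69,108); (0,29,99,115);
    (0,26,82,122); (0,22,94,124); (0,32,74,119); (0,24,41,86)])]);
  ((7, 27)%nat, [:: 7], [:: 27],
   [:: (189%nat, [:: (0,45,71,144); (0,52,94,153); (0,30,73,159); (0,28,75,107); (0,37,61,103);
    (0,33,89,181); (0,39,58,134); (0,44,91,114); (0,34,85,168); (0,40,104,118); (0,38,60,110);
    (0,29,65,149); (0,31,101,154)])]);
  ((10, 5)%nat, [:: 3; 3; 3; 1], [:: 5],
   [:: (15%nat, [:: (0,9,42,46); (0,18,21,49); (15,39,41,47); (0,24,31,48); (15,22,38,44); (0,22,28,36);
    (0,6,39,43); (0,26,32,44); (0,7,19,23); (0,8,17,34)])]);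
  ((10, 8)%nat, [:: 10], [:: 7; 1],
   [:: (70%nat, [:: (0,22,55,61); (0,23,37,60); (0,15,33,68); (0,10,69,73); (0,13,38,51); (0,9,21,43)])]);
  ((10, 9)%nat, [:: 10], [:: 9],
   [:: (90%nat, [:: (0,16,24,41); (0,12,55,78); (0,14,40,84); (0,10,61,77); (0,13,50,69); (0,11,39,68)])]);
  ((10, 11)%nat, [:: 5; 5], [:: 11],
   [:: (55%nat, [:: (0,63,81,106); (0,78,98,108); (0,83,91,107); (0,21,72,95); (0,59,87,93); (0,16,61,96);
    (0,14,60,67); (0,70,84,97); (0,29,68,94); (0,28,86,90); (0,17,24,71); (0,19,39,82); (0,12,32,69);
    (0,13,36,92); (0,15,40,104)])]);
  ((10, 12)%nat, [:: 10], [:: 11; 1],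
   [:: (110%nat, [:: (0,15,26,82); (0,21,83,89); (0,14,34,47); (0,18,58,107); (0,25,54,93); (0,17,76,103);
    (0,16,57,99); (0,19,69,88); (0,13,44,98)])]);
  ((10, 15)%nat, [:: 10], [:: 14; 1],
   [:: (35%nat, [:: (0,53,82,121)]); (70%nat, [:: (0,18,67,76); (0,22,48,119); (0,26,95,126); (0,42,89,106);
    (0,20,100,107); (0,34,103,147); (0,57,70,143); (0,32,97,117); (0,17,56,66); (0,39,51,62); (0,16,52,63);
    (0,27,109,136); (0,33,99,118); (0,35,68,129); (0,19,110,149); (0,43,81,91); (0,23,37,55); (0,29,71,93);
    (0,31,77,111); (1,29,39,111); (1,17,59,109); (1,23,51,125)])]);
  ((10, 19)%nat, [:: 9; 1], [:: 19],
   [:: (171%nat, [:: (0,21,137,176); (0,26,128,189); (0,50,131,185); (0,28,80,188); (0,22,100,186);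
    (0,55,96,178); (0,30,46,63); (0,27,132,147); (0,20,68,113); (0,31,98,149); (0,29,121,134);
    (0,37,82,117); (0,24,49,89); (0,23,107,146); (0,33,61,148)])]);
  ((10, 27)%nat, [:: 5; 5], [:: 13; 13; 1],
   [:: (65%nat, [:: (0,28,134,177); (0,29,59,197); (0,31,69,198); (0,32,66,213); (0,33,77,192);
    (0,35,129,164); (0,36,121,166); (0,37,72,206); (0,38,109,174); (0,40,125,185); (0,41,132,178);
    (0,42,73,190); (0,43,60,203); (0,45,74,214); (0,46,70,196); (0,47,58,210); (0,49,56,215); (0,50,76,202);
    (0,52,122,180); (0,53,133,184); (0,55,151,267); (0,57,157,268); (0,61,141,254); (0,62,147,244);
    (0,63,154,251); (0,65,153,257); (0,67,137,264); (0,68,158,260); (0,71,155,246); (0,75,150,269);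
    (0,78,145,250); (0,79,139,256); (0,80,140,252); (0,95,130,144); (0,96,199,238); (0,97,209,221);
    (0,99,191,232); (0,100,207,218); (0,101,194,222); (0,102,127,146); (0,103,208,234); (0,104,204,226);
    (0,105,126,148); (0,106,123,159); (0,163,224,253); (0,165,233,247); (0,169,240,261); (0,170,225,259);
    (0,171,242,255); (0,173,223,266); (0,175,241,258); (0,176,227,263); (0,179,230,265); (0,183,229,248);
    (0,186,217,249); (0,187,219,245); (0,188,237,262); (13,41,74,199); (13,45,125,164); (13,53,75,195);
    (13,69,151,246); (13,71,140,258); (13,72,136,250); (13,73,149,249); (13,77,156,262); (13,79,161,247);
    (13,107,209,216); (13,165,231,244); (13,166,241,264); (13,168,235,263); (13,169,234,269);
    (13,170,227,245); (13,172,224,248); (13,173,222,267); (13,177,233,243); (13,179,226,259);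
    (13,180,219,252); (13,181,239,255); (13,185,220,257); (13,187,223,265); (26,175,235,250)])]);
  ((19, 5)%nat, [:: 19], [:: 5],
   [:: (95%nat, [:: (0,11,37,84); (0,6,18,72); (0,9,17,68); (0,14,48,67); (0,7,46,69); (0,8,29,81)])]);
  ((19, 8)%nat, [:: 19], [:: 7; 1],
   [:: (133%nat, [:: (0,9,75,110); (0,14,53,107); (0,21,68,90); (0,19,63,86); (0,31,33,74); (0,13,36,78);
    (0,25,82,119); (0,20,50,71); (0,11,26,38); (0,17,103,116); (0,15,45,89); (0,10,28,125)])]);
  ((19, 9)%nat, [:: 19], [:: 9],
   [:: (171%nat, [:: (0,17,132,149); (0,19,116,159); (0,16,62,119); (0,10,32,146); (0,12,35,106);
    (0,24,65,120); (0,11,70,138); (0,28,101,139); (0,13,102,160); (0,15,49,91); (0,29,96,133);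
    (0,14,93,155)])]);
  ((19, 11)%nat, [:: 19], [:: 11],
   [:: (209%nat, [:: (0,13,175,181); (0,29,90,111); (0,31,81,140); (0,28,125,174); (0,19,62,115);
    (0,21,86,101); (0,27,75,147); (0,18,41,190); (0,25,57,153); (0,14,56,98); (0,38,78,141); (0,34,70,152);
    (0,16,149,196); (0,12,97,106); (0,15,50,155)])]);
  ((19, 12)%nat, [:: 19], [:: 11; 1],
   [:: (209%nat, [:: (0,38,94,185); (0,33,89,203); (0,25,173,215); (0,23,98,177); (0,27,59,69);
    (0,30,65,131); (0,31,78,167); (0,14,123,205); (0,13,52,223); (0,20,99,142); (0,40,113,157);
    (0,18,105,151); (0,17,51,121); (0,19,85,135); (0,15,169,213); (0,28,138,207); (0,21,86,186);
    (0,22,114,175)])]);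
  ((19, 15)%nat, [:: 19], [:: 15],
   [:: (285%nat, [:: (0,29,199,258); (0,65,147,224); (0,16,55,168); (0,50,139,193); (0,20,83,108);
    (0,22,68,183); (0,21,144,242); (0,43,79,137); (0,23,116,126); (0,41,121,208); (0,34,140,262);
    (0,18,70,112); (0,48,145,219); (0,37,98,136); (0,44,154,238); (0,19,138,234); (0,49,149,222);
    (0,26,110,142); (0,17,86,119); (0,28,80,269); (0,24,36,71)])]);
  ((19, 19)%nat, [:: 19], [:: 9; 9; 1],
   [:: (171%nat, [:: (0,20,78,222); (0,21,96,336); (0,22,271,357); (0,23,102,314); (0,24,200,355);
    (0,25,231,341); (0,26,80,143); (0,27,87,273); (0,28,52,359); (0,29,118,216); (0,30,103,254);
    (0,31,59,196); (0,32,134,173); (0,33,42,93); (0,34,303,358); (0,35,47,201); (0,36,109,194);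
    (0,37,177,250); (0,40,145,253); (0,41,132,310); (0,43,167,212); (0,44,88,230); (0,45,125,217);
    (0,46,248,354); (0,48,81,298); (0,49,92,161); (0,50,229,293); (0,54,170,338); (0,55,299,332);
    (0,56,186,206); (0,61,131,223); (0,62,136,243); (0,65,164,191); (0,66,225,296); (0,67,119,260);
    (0,68,130,237); (0,71,169,218); (0,73,246,319); (0,74,261,313); (0,75,91,301); (0,85,166,302);
    (0,90,156,321); (0,100,238,279); (0,104,204,283); (0,110,282,360); (0,111,199,239); (0,112,128,232);
    (0,123,242,264); (0,129,263,284); (0,142,245,280); (0,148,208,244); (0,149,258,275); (0,163,256,320);
    (0,168,224,265); (0,180,207,356); (0,187,277,351); (0,294,339,353)])]);
  ((19, 27)%nat, [:: 19], [:: 27],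
   [:: (513%nat, [:: (0,28,154,493); (0,29,247,390); (0,30,86,326); (0,31,83,239); (0,32,165,312);
    (0,33,177,356); (0,34,365,458); (0,35,374,460); (0,36,136,295); (0,37,97,221); (0,38,196,357);
    (0,39,176,265); (0,40,87,242); (0,41,264,289); (0,42,111,212); (0,43,343,408); (0,44,348,398);
    (0,45,118,409); (0,46,256,487); (0,48,278,485); (0,49,128,272); (0,50,90,472); (0,51,287,426);
    (0,57,119,425); (0,58,225,388); (0,59,168,462); (0,61,178,347); (0,63,157,203); (0,64,269,474);
    (0,65,294,471); (0,70,274,395); (0,71,285,360); (0,76,153,455); (0,84,182,353); (0,95,249,435);
    (0,99,305,417); (0,107,279,420); (0,122,220,349); (0,124,288,407)])]);
  ((4, 10)%nat, [:: 2; 2], [:: 9; 1],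
   [:: (18%nat, [:: (0,13,21,39); (0,14,23,32); (0,12,26,31); (0,11,24,36); (0,19,22,35)])]);
  ((7, 10)%nat, [:: 7], [:: 9; 1],
   [:: (63%nat, [:: (0,13,36,51); (0,11,26,52); (0,18,29,31); (0,12,46,54); (0,14,49,63)])])].

End Designs.

Lemma gm_design w k x : (w, k, x) \in [seq d.1.1 | d <- gm_designs] -> dec (gm w k x).
Proof.
have : all (fun d => (0 < d.1.1.1.1) && check_gm d.1.1.1.1 d.1.1.1.2 d.1.1.2 d.1.2 d.2) gm_designs.
  by vm_compute.
by move=> /allP h /mapP[[[[[w' k'] x'] cyc] base] /h/andP[w0 hd] [-> -> ->]]; apply: check_gm_dec hd w0.
Qed.

Lemma mg_design k u : (k, u) \in [seq d.1.1.1 | d <- mg_designs] -> dec (mg k u).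
Proof.
have /allP h : all (fun d => check_mg d.1.1.1.1 d.1.1.1.2 d.1.1.2 d.1.2 d.2) mg_designs.
  by vm_compute.
by case/mapP=> -[[[[k' u'] rc] cc] base] /h hd [-> ->]; apply: check_mg_dec hd.
Qed.

(** * Pairwise balanced designs *)

Definition pbd (K : pred nat) v := kdec K (fun x y : nat => (x < v) && (y < v)).

Lemma sub_kdec (T : eqType) (K K' : pred nat) (R : rel T) :
  (forall k, K k -> K' k) -> kdec K R -> kdec K' R.
Proof. by move=> sK [B [hB cB]]; exists B; split=> // b /hB[? /sK]. Qed.

Lemma kdec0 (T : eqType) (K : pred nat) (R : rel T) : (forall x y, x != y -> ~~ R x y) -> kdec K R.
Proof. by move=> nR; exists [::]; split=> // x y /nR/negPf->. Qed.

Lemma kdec_block (T : eqType) (K : pred nat) (b : seq T) (R : rel T) :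
    uniq b -> K (size b) -> (forall x y, x != y -> R x y = (x \in b) && (y \in b)) ->
  kdec K R.
Proof.
move=> ub kb eR; exists [:: b]; split=> [c|x y xy]; first by rewrite inE => /eqP->.
by rewrite /= addn0 eR.
Qed.

Lemma pbd_pred1 v : pbd (pred1 v) v.
Proof.
apply: (kdec_block (b := iota 0 v)); rewrite ?iota_uniq ?size_iota //= => x y _.
by rewrite !mem_iota.
Qed.

Lemma pbd1 K v : v <= 1 -> pbd K v.
Proof. by move=> v1; apply: kdec0 => x y; lia. Qed.

(** Above a clique on [k] vertices the tensor product with K_u restricts to K_k x K_u, so Wilson's
    construction applies along the second projection. A general [R] allows for truncated transversal
    designs. *)
Lemma kdec_mg (K : pred nat) (R : rel nat) u :
    kdec K R -> (forall k, K k -> dec (mg k u)) ->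
  dec (fun x y : nat * nat =>
    [&& x.1 != y.1, x.1 < u, y.1 < u, x.2 != y.2 & R x.2 y.2]).
Proof.
move=> hR hK; pose R' := fun x y : nat * nat => [&& x.1 != y.1, x.1 < u & y.1 < u].
apply: eq_kdec (kdec_wilson (p := snd) (R' := R') hR _) => [x y _|b ub kb cl].
  by rewrite /R' /= -!andbA.
apply: (kdec_map (S := fun p : nat * nat => p.2 < size b)
  (f := fun p => (p.1, nth 0 b p.2))) (hK _ kb).
- by move=> [a i] [c j] /= ib jb [-> /eqP]; rewrite nth_uniq // => /eqP->.
- by move=> a c _ /and4P[_ _ _ /andP[]].
- move=> [a i] [c j] /= ib jb _; rewrite /R' /mg /= ib jb nth_uniq // !mem_nth // !andbT.
  by rewrite -!andbA; congr (_ && _); rewrite andbCA [RHS]andbC -!andbA andbCA.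
- move=> [a i] [c j] _ /and4P[_ _ ib jb]; exists (a, index i b), (c, index j b).
  by rewrite /= !index_mem !nth_index.
Qed.

Lemma mg_pbd (K : pred nat) v u : pbd K v -> (forall k, K k -> dec (mg k u)) -> dec (mg v u).
Proof.
by move=> hv hK; apply: eq_kdec (kdec_mg hv hK) => x y _; rewrite /mg; do !bool_congr.
Qed.

Lemma mg_sym k u : dec (mg k u) -> dec (mg u k).
Proof.
apply: (kdec_map (S := predT) (f := fun p => (p.2, p.1))) => //.
- by move=> [a b] [c d] _ _ [-> ->].
- by move=> [a b] [c d] _ _ _; rewrite /mg /=; do !bool_congr.
- by move=> [a b] [c d] _ _; exists (b, a), (d, c).
Qed.

Lemma mg1 k u : k <= 1 -> dec (mg k u).
Proof. by move=> k1; apply: kdec0 => x y _; apply/negP => /and4P[_ ? _ /andP[]]; lia. Qed.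

Lemma pbd_gm (K : pred nat) u m : K 4 -> dec (gm 1 u m) -> pbd K m -> pbd K (u + m).
Proof.
move=> K4 hu hm; apply: (kdec_key (s := iota 0 2) (k := fun x y => ((u <= x) && (u <= y)) : nat)).
- exact: iota_uniq.
- move=> i; rewrite mem_iota => /andP[_]; case: i => [|[|//]] _.
    have {}hu : kdec K (gm 1 u m) by apply: sub_kdec hu => k /eqP->.
    pose S p := p.2 < gsize 1 u m p.1.
    have SE a i : S (a, i) = (a < u) && (i == 0) || (a == u) && (i < m).
      by rewrite /S /gsize /=; case: (ltngtP a u) => /= _; lia.
    apply: (kdec_map (S := S) (f := fun p => p.1 + p.2)) hu.
    + move=> [a i] [b j]; rewrite -!topredE /= !SE => aS bS /= e; congr pair; lia.
    + by move=> a b _ /and3P[].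
    + move=> p q pS qS pq; rewrite /gm -[p.2 < _]/(S p) -[q.2 < _]/(S q) pS qS !andbT.
      move: p q pS qS pq => [a i] [b j] /=; rewrite !SE xpair_eqE => ha hb ab.
      by apply/idP/idP; lia.
    + move=> x y xy /andP[/andP[xm ym] _].
      have E t : t < u + m -> exists p, S p /\ t = p.1 + p.2.
        have [tu _|ut tm] := ltnP t u; first by exists (t, 0); rewrite SE tu /= addn0.
        by exists (u, t - u); rewrite SE eqxx /=; lia.
      have [p [pS ex]] := E _ xm; have [q [qS ey]] := E _ ym.
      by exists p, q.
  apply: (kdec_map (S := fun t : nat => t < m) (f := addn u)) hm => /=.
  + by move=> a b _ _; apply: addnI.
  + by move=> a b _ /andP[].
  + by move=> a b am bm _; rewrite !leq_addr !ltn_add2l /= andbT.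
  + move=> x y _ /andP[/andP[xm ym]]; case: andP => // -[ux uy] _.
    by exists (x - u), (y - u); split; lia.
- by move=> x y _ _; case: (_ && _).
Qed.

(** * Truncated transversal designs *)

(* The rows of an orthogonal array of order [n] on the columns satisfying [C]. *)
Definition oa n (C : pred nat) (L : seq (seq nat)) :=
  (forall r i, r \in L -> C i -> nth 0 r i < n) /\
  forall i j x y, C i -> C j -> i != j -> x < n -> y < n ->
    count (fun r => (nth 0 r i == x) && (nth 0 r j == y)) L = 1.

Lemma divmodMD n i x : x < n -> ((n * i + x) %/ n = i) * ((n * i + x) %% n = x).
Proof.
move=> xn; have n0 : 0 < n by case: n xn.
by rewrite mulnC divnMDl // divn_small // addn0 modnMDl modn_small.
Qed.

(* Points of a transversal design with groups 0, ..., 3 of size [n] and a group 4 of size [r]. *)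
Definition trunc n r : rel nat := fun x y =>
  [&& x < 4 * n + r, y < 4 * n + r & x %/ n != y %/ n].

(** Row [l] becomes the block with point [nth 0 l i] in group [i]. Its fifth point survives the
    truncation exactly when that entry is below [r], whence the block sizes 4 and 5. *)
Lemma kdec_trunc n r L : oa n (fun i => i < 5) L -> 0 < n -> r <= n ->
  kdec (pred2 4 5) (trunc n r).
Proof.
move=> [ltL cL] n0 rn; pose S x := x < 4 * n + r.
have div5 x : S x -> x %/ n < 5 by rewrite ltn_divLR //; rewrite /S; lia.
pose Q (l : seq nat) x := S x && (nth 0 l (x %/ n) == x %% n).
apply: (kdec_sum (s := L)
  (Q := fun l x y => [&& x %/ n != y %/ n, Q l x & Q l y])).
  move=> l lL; pose b := [seq n * i + nth 0 l i | i <- iota 0 4] ++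
    (if nth 0 l 4 < r then [:: n * 4 + nth 0 l 4] else [::]).
  have ltl i : i < 5 -> nth 0 l i < n by move/(ltL l i lL).
  have bE x : (x \in b) = Q l x.
    rewrite mem_cat /Q; apply/orP/andP.
      case=> [/mapP[i]|].
        rewrite mem_iota => /andP[_ i4] ->; have il := ltl i (leqW i4).
        by rewrite /S !divmodMD ?eqxx //; split=> //; nia.
      case: ifP => // lr; rewrite inE => /eqP->.
      by rewrite /S !divmodMD ?ltl ?eqxx //; split=> //; lia.
    case=> xS /eqP ex; have ix := div5 _ xS; have := divn_eq x n; rewrite -ex mulnC => ex'.
    have [i4|i4] := ltnP (x %/ n) 4.
      by left; apply/mapP; exists (x %/ n); rewrite ?mem_iota.
    have e4 : x %/ n = 4 by lia.
    right; rewrite e4 in ex'; move: xS; rewrite /S ex' => xS.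
    by have -> : nth 0 l 4 < r by [lia]; rewrite inE.
  have inj i j : i < 5 -> j < 5 -> (n * i + nth 0 l i == n * j + nth 0 l j) = (i == j).
    move=> i5 j5; apply/eqP/eqP => [e|-> //].
    by have := congr1 (fun t => t %/ n) e; rewrite /= !divmodMD ?ltl.
  apply: (kdec_block (b := b)).
  - rewrite cat_uniq map_inj_in_uniq ?iota_uniq; last first.
      move=> i j; rewrite !mem_iota => /andP[_ i4] /andP[_ j4] /eqP.
      by rewrite inj ?(leqW i4) ?(leqW j4) // => /eqP.
    by case: ifP => //= _; rewrite !orbF !inE !inj.
  - by rewrite size_cat size_map /=; case: ifP.
  - move=> x y xy; rewrite !bE; case Qx: (Q l x); case Qy: (Q l y); rewrite ?andbF //= ?andbT.
    apply: contra_neq xy => e; move: Qx Qy => /andP[_ /eqP ex] /andP[_ /eqP ey].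
    by rewrite (divn_eq x n) (divn_eq y n) -ex -ey e.
move=> x y xy; rewrite /trunc -/(S x) -/(S y).
case xS: (S x); last by rewrite big1 // => l _; rewrite /Q xS /= andbF.
case yS: (S y); last by rewrite big1 // => l _; rewrite /Q yS /= !andbF.
have [e|ne] := eqVneq (x %/ n) (y %/ n); first by rewrite big1.
rewrite /= -(cL _ _ (x %% n) (y %% n) (div5 _ xS) (div5 _ yS) ne) ?ltn_mod //.
rewrite -sum1_count [RHS]big_mkcond; apply: eq_bigr => l _.
by rewrite /Q xS yS /=; case: ifP.
Qed.

(* The parts of [w] consecutive points are filled together with [e <= 1] common extra points. *)
Lemma pbd_parts (K : pred nat) w v e : 0 < w -> e <= 1 ->
    kdec K (fun x y => [&& x < v, y < v & x %/ w != y %/ w]) ->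
    (forall i, w * i < v -> pbd K (minn w (v - w * i) + e)) ->
  pbd K (v + e).
Proof.
move=> w0 e1 hv hp.
(* Label [v] stands for pairs from different parts; a pair with the extra point [v] gets the part of
   the other point. Part numbers of points are below [v], so the labels do not clash. *)
pose key x y := if [&& x < v, y < v & x %/ w != y %/ w] then v
  else if x < v then x %/ w else y %/ w.
have dv x : x < v -> x %/ w < v by apply: leq_ltn_trans; apply: leq_div.
apply: (kdec_key (s := iota 0 v.+1) (k := key)); first exact: iota_uniq.
  move=> i; rewrite mem_iota add0n ltnS => /andP[_]; rewrite leq_eqVlt => /orP[/eqP->|iv].
    apply: eq_kdec hv => x y xy; rewrite /key.
    case xv: (x < v); case yv: (y < v) => /=; rewrite ?andbF ?andbT //.
    - rewrite !(ltn_addr _ xv) !(ltn_addr _ yv) /=; case: ifP => _; rewrite ?eqxx //.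
      by rewrite (ltn_eqF (dv _ xv)).
    - by rewrite (ltn_eqF (dv _ xv)) andbF.
    - by rewrite (ltn_eqF (dv _ yv)) andbF.
    - by rewrite (_ : _ && _ = false) //; move/negbT: xv; move/negbT: yv; lia.
  have [wiv|vwi] := ltnP (w * i) v; last first.
    have no x : x < v -> x %/ w <> i.
      by move=> xv ei; have := leq_divM x w; rewrite ei mulnC; lia.
    apply: kdec0 => x y xy; rewrite /key; apply/negP => /andP[/andP[xe ye]].
    case xv: (x < v); case yv: (y < v) => /=; last by lia.
    - by case: ifP => _ /eqP; [lia | apply: no].
    - by move/eqP; apply: no.
    - by move/eqP; apply: no.
  have := hp i wiv; set t := minn _ _ => ht.
  have tb : t <= w /\ w * i + t <= v by rewrite /t; split; lia.
  have di a : a < t -> (w * i + a) %/ w = i by move=> ?; rewrite (divmodMD i) //; lia.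
  pose f a := if a < t then w * i + a else v.
  have fv a : a < t -> f a < v by move=> at_; rewrite /f at_; lia.
  have fi a : a < t -> f a %/ w = i by rewrite /f => at_; rewrite at_ di.
  have fe a : a < t = false -> f a = v by rewrite /f => ->.
  apply: (kdec_map (S := fun a : nat => a < t + e) (f := f)) ht.
  - move=> a b; rewrite -!topredE /= => ae be; rewrite /f.
    by case: ifP => ?; case: ifP => ?; lia.
  - by move=> a b _ /andP[].
  - move=> a b ae be ab; rewrite ae be /= /key; case at_: (a < t); case bt: (b < t).
    + by rewrite !fi // eqxx !fv // !ltn_addr ?fv ?eqxx.
    + by rewrite (fe b) // ltnn !fv // fi // eqxx andbT; have := fv _ at_; lia.
    + by rewrite (fe a) // ltnn fi // eqxx andbT; have := fv _ bt; lia.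
    + by lia.
  - move=> x y xy /andP[/andP[xe ye]]; rewrite /key.
    have E x' : x' < v -> x' %/ w = i -> exists a, (a < t + e) && (x' == f a).
      move=> xv xi; have := divn_eq x' w; rewrite xi => ex; have := ltn_pmod x' w0 => lx.
      exists (x' %% w); rewrite /f; have -> : x' %% w < t by rewrite /t; lia.
      by apply/andP; split; [lia | apply/eqP; lia].
    have E' x' : v <= x' -> x' < v + e -> exists a, (a < t + e) && (x' == f a).
      by move=> vx xe'; exists t; rewrite fe ?ltnn //; lia.
    have fin : (exists a, (a < t + e) && (x == f a)) -> (exists a, (a < t + e) && (y == f a)) ->
        exists a b, [/\ a < t + e, b < t + e, x = f a & y = f b].
      by move=> [a /andP[ae /eqP ea]] [b /andP[be /eqP eb]]; exists a, b.
    case xv: (x < v); case yv: (y < v) => /=.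
    + case: ifP => [_|/negbFE/eqP exy /eqP ei]; first by move/eqP; lia.
      by apply: fin; apply: E => //; rewrite -exy.
    + by move/eqP=> ei; apply: fin; [apply: E | apply: E' => //; rewrite leqNgt yv].
    + by move/eqP=> ei; apply: fin; [apply: E' => //; rewrite leqNgt xv | apply: E].
    + by lia.
move=> x y xy /andP[xe ye]; rewrite mem_iota add0n /= /key ltnS.
case: ifP => // _; case: ifP => [/dv/ltnW //|xv]; have [/dv/ltnW //|yv] := ltnP y v.
by lia.
Qed.

Lemma minn_trunc n r i : 0 < n -> r <= n -> n * i < 4 * n + r ->
  minn n (4 * n + r - n * i) = n \/ minn n (4 * n + r - n * i) = r.
Proof.
move=> n0 rn ig; have [i4|i4] := ltnP i 4; [left | right].
  by have : n * i <= n * 3 by [rewrite leq_mul2l -ltnS i4 orbT]; lia.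
have i5 : i < 5 by rewrite -(ltn_pmul2l n0); lia.
by have -> : i = 4 by [lia]; lia.
Qed.

Lemma pbd_trunc (K : pred nat) n r L : oa n (fun i => i < 5) L -> 0 < n -> r <= n ->
  K 4 -> K 5 -> pbd K n -> pbd K r -> pbd K (4 * n + r).
Proof.
move=> hL n0 rn K4 K5 hn hr; rewrite -[_ + r]addn0; apply: (@pbd_parts K n) => // [|i ig].
  by apply: sub_kdec (kdec_trunc hL n0 rn) => k /orP[]/eqP->.
by rewrite addn0; have [->|->] := minn_trunc n0 rn ig.
Qed.

Lemma kdec_inflate (T : eqType) (K : pred nat) (R : rel T) w :
    kdec K R -> (forall k, K k -> dec (gm w k 0)) ->
  dec (fun x y : T * nat => [&& x.2 < w, y.2 < w, x.1 != y.1 & R x.1 y.1]).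
Proof.
move=> hR hK; pose R' := fun x y : T * nat => (x.2 < w) && (y.2 < w).
apply: eq_kdec (kdec_wilson (p := fst) (R' := R') hR _) => [x y _|b ub kb cl].
  by rewrite /R' /= -!andbA.
case: b ub kb cl => [|x0 b'] ub kb cl; first by apply: kdec0 => x y _; rewrite !andbF.
set b := x0 :: b' in ub kb cl *.
pose S (p : nat * nat) := (p.1 < size b) && (p.2 < w).
have SE k p : k = size b -> (p.2 < gsize w k 0 p.1) = S p.
  by move=> ->; rewrite /gsize /S; case: ifP => //; case: ifP.
apply: (kdec_map (S := S) (f := fun p => (nth x0 b p.1, p.2))) (hK _ kb).
- by move=> [i a] [j c] /andP[/= ib _] /andP[/= jb _] [/eqP]; rewrite nth_uniq // => /eqP-> ->.
- by move=> p q _ /and3P[_]; rewrite !SE.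
- move=> p q pS qS _; rewrite /gm !SE // pS qS !andbT /R' /=.
  by move: pS qS => /andP[pb pw] /andP[qb qw]; rewrite pw qw !mem_nth // nth_uniq //= andbT.
- move=> [x a] [y c] _ /and4P[/andP[/= aw cw] _ xb yb]; exists (index x b, a), (index y b, c).
  have Sx z d : z \in b -> d < w -> S (index z b, d).
    by move=> zb dw; apply/andP; rewrite index_mem.
  by split; [exact: Sx | exact: Sx | congr pair | congr pair]; rewrite nth_index.
Qed.

Lemma mul_add_inj w a c b d : a < w -> c < w -> b * w + a = d * w + c -> b = d /\ a = c.
Proof.
move=> aw cw e; have w0 : 0 < w by lia.
have := congr1 (fun t => t %/ w) e; rewrite !divnMDl // !divn_small // !addn0 => bd.
by split=> //; move: e; rewrite bd => /addnI.
Qed.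

Lemma mul_add_ltn w g a b : a < g -> b < w -> a * w + b < w * g.
Proof.
move=> ag bw; have : a.+1 * w <= w * g by rewrite mulnC leq_mul2l ag orbT.
by apply: leq_trans; rewrite mulSnr ltn_add2l.
Qed.

(* The [g] rows, each of width [w], are grouped into bunches of [n] consecutive rows. *)
Lemma gm_bunches n w g k x : 0 < n ->
    dec (fun p q : nat * nat => [&& p.1 != q.1, (p.1 < k) && (q.1 < k),
      (p.2 < g) && (q.2 < g) & p.2 %/ n != q.2 %/ n]) ->
    dec (gm w 4 0) ->
    (forall i, n * i < g -> dec (gm (w * minn n (g - n * i)) k x)) ->
  dec (gm (w * g) k x).
Proof.
move=> n0 hm h4 hx; have [w0|w0] := posnP w.
  apply: kdec0 => p q _; rewrite w0 mul0n; apply/negP => /and3P[].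
  by rewrite /gsize; do !case: ifP => //; lia.
have wn0 : 0 < w * n by rewrite muln_gt0 w0.
have dvw r a : a < w -> (r * w + a) %/ (w * n) = r %/ n.
  by move=> aw; rewrite divnMA divnMDl // (divn_small aw) addn0.
have qg t : t < w * g -> t %/ w < g by rewrite ltn_divLR // mulnC.
have qgn t : t < w * g -> t %/ (w * n) < g.
  by move=> /qg; apply: leq_ltn_trans; rewrite divnMA leq_div.
(* Label [g] collects the pairs of different bunches within the first [k] groups. Label [i] collects
   the pairs inside bunch [i] and those joining it to the group of size [x], which all bunches
   share. Bunch numbers are below [g]. *)
pose key (p q : nat * nat) :=
  if (p.1 < k) && (q.1 < k) && (p.2 %/ (w * n) != q.2 %/ (w * n)) then g
  else if p.1 < k then p.2 %/ (w * n) else q.2 %/ (w * n).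
apply: (kdec_key (s := iota 0 g.+1) (k := key)); first exact: iota_uniq.
  move=> i; rewrite mem_iota add0n ltnS => /andP[_]; rewrite leq_eqVlt => /orP[/eqP->|ig].
    have: dec (fun x y : nat * nat * nat => [&& x.2 < w, y.2 < w, x.1 != y.1 &
        [&& x.1.1 != y.1.1, (x.1.1 < k) && (y.1.1 < k),
        (x.1.2 < g) && (y.1.2 < g) & x.1.2 %/ n != y.1.2 %/ n]]).
      by apply: kdec_inflate hm _ => _ /eqP->.
    pose S (p : nat * nat * nat) := [&& p.2 < w, p.1.1 < k & p.1.2 < g].
    apply: (kdec_map (S := S) (f := fun p => (p.1.1, p.1.2 * w + p.2))).
    - move=> [[c r] a] [[c' r'] a'] /and3P[/= aw _ _] /and3P[/= aw' _ _] [-> /mul_add_inj].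
      by case=> // -> ->.
    - move=> [[c r] a] [[c' r'] a'] _ /and4P[/= aw aw' _ /and4P[_ /andP[ck ck'] /andP[rg rg'] _]].
      by rewrite /S /= aw aw' ck ck' rg rg'.
    - move=> [[c r] a] [[c' r'] a'] /and3P[/= aw ck rg] /and3P[/= aw' ck' rg'] _.
      rewrite /gm /key /gsize /= ck ck' rg rg' aw aw' /= !dvw //.
      rewrite xpair_eqE; have -> : r * w + a < w * g by nia.
      have -> : r' * w + a' < w * g by nia.
      rewrite /= andbT; have [_|_] := eqVneq c c'; rewrite /= ?andbF //.
      have [e|ne] := eqVneq (r %/ n) (r' %/ n); rewrite /= ?eqxx ?andbF ?andbT //.
        by apply/negbTE; rewrite neq_ltn (leq_ltn_trans (leq_div _ _) rg).
    - move=> [c q] [c' q'] _ /andP[/and3P[/= cc qs qs']]; rewrite /key /=.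
      case: ifP => [/andP[/andP[ck ck'] _] _|nk].
        move: qs qs'; rewrite /gsize ck ck' => qs qs'.
        exists ((c, q %/ w), q %% w), ((c', q' %/ w), q' %% w).
        by rewrite /S /= !ltn_mod w0 ck ck' !qg // -!divn_eq.
      case: ifP => [ck /eqP eg|nck /eqP eg].
        by move: qs; rewrite /gsize ck => /qgn; rewrite eg ltnn.
      move: cc qs qs'; rewrite /gsize nck; case: (c =P k) => // -> kc _.
      case: ifP => [_ /qgn|]; first by rewrite eg ltnn.
      by rewrite eq_sym (negPf kc).
  have [nig|nig] := ltnP (n * i) g; last first.
    have no t : t < w * g -> t %/ (w * n) <> i.
      by move=> tg e; have := leq_divM t (w * n); rewrite e; nia.
    apply: kdec0 => p q pq; rewrite /gm /key /gsize.
    case pk: (p.1 < k); case qk: (q.1 < k); rewrite /= ?andbF ?andbT;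
      apply/negP => /andP[/and3P[cc ps qs]].
    + by case: ifP => _ /eqP e; [move: ig; rewrite -e ltnn | case: (no _ ps)].
    + by move/eqP; apply: no.
    + by move/eqP; apply: no.
    + by move: ps qs cc; case: (p.1 =P k) => // ->; case: (q.1 =P k) => // ->; rewrite eqxx.
  have := hx i nig; set s := minn n (g - n * i) => hs.
  pose S (p : nat * nat) := p.2 < gsize (w * s) k x p.1.
  have dv t : t < w * s -> (i * (w * n) + t) %/ (w * n) = i.
    move=> tw; rewrite divnMDl // divn_small ?addn0 //; apply: leq_trans tw _.
    by rewrite leq_mul2l geq_minl orbT.
  apply: (kdec_map (S := S) (f := fun p => (p.1, if p.1 < k then i * (w * n) + p.2 else p.2))) hs.
  - move=> [c a] [c' a'] _ _ [->] /=; case: ifP => _; last by move->.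
    by move/addnI->.
  - by move=> p q _ /and3P[].
  - have Sf p : S p -> (if p.1 < k then i * (w * n) + p.2 else p.2) < gsize (w * g) k x p.1.
      rewrite /S /gsize; case: ifP => // _ ps.
      have /(leq_mul (leqnn w)) : s <= g - n * i by apply: geq_minr.
      by nia.
    move=> p q pS qS _; rewrite /gm /= !Sf // -[_ < gsize _ _ _ _]/(S p).
    rewrite -[_ < gsize _ _ _ q.1]/(S q) pS qS !andbT /key /=; case: eqVneq => //= pq.
    move: pS qS; rewrite /S /gsize; case pk: (p.1 < k); case qk: (q.1 < k) => /= pS qS;
      rewrite ?dv ?eqxx //.
    by move: pS qS pq; case: (p.1 =P k) => // ->; case: (q.1 =P k) => // ->; rewrite eqxx.
  - move=> [c q] [c' q'] _ /andP[/and3P[/= cc qs qs']]; rewrite /key /=.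
    have E c0 t : t < gsize (w * g) k x c0 -> (c0 < k -> t %/ (w * n) = i) ->
        exists p, S p /\ (c0, t) = (p.1, if p.1 < k then i * (w * n) + p.2 else p.2).
      rewrite /gsize; case: ifP => [ck tg ti|ck tx _].
        have et : t = i * (w * n) + t %% (w * n) by rewrite {1}(divn_eq t (w * n)) ti.
        exists (c0, t %% (w * n)); rewrite /S /gsize /= ck -et; split=> //.
        have := ltn_pmod t wn0; rewrite /s /minn; case: ifP => // _ tn.
        by rewrite mulnBr; move: tg et; nia.
      by exists (c0, t); rewrite /S /gsize /= ck tx.
    case: ifP => [_ /eqP|nk]; first by lia.
    move=> e; have [|p [pS ep]] := E _ _ qs; first by move=> ck; move: e; rewrite ck => /eqP.
    have [|p' [pS' ep']] := E _ _ qs'; last by exists p, p'.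
    move=> ck'; move: e nk; rewrite ck'; case: ifP => [_ /eqP <-|_ /eqP //].
    by move/negbT; rewrite negbK => /eqP.
move=> p q _ /and3P[pq ps qs]; rewrite mem_iota add0n /= /key.
case: ifP => _; first by rewrite ltnSn.
have qgS t : t < w * g -> t %/ (w * n) < g.+1 by move=> /qgn; apply: leqW.
case: ifP => pk; first by move: ps; rewrite /gsize pk => /qgS.
move: ps qs pq; rewrite /gsize pk; case: (p.1 =P k) => // -> _; case: ifP => [_ /qgS //|_].
by case: eqP => // ->; rewrite eqxx.
Qed.

(** Bunches of one row: each of the [g] rows carries its own design of type w^k x^1 on the common
    last group, and the pairs from different rows form K_g x K_k with weight [w]. *)
Lemma gm_rows w g k x :
  dec (mg g k) -> dec (gm w 4 0) -> dec (gm w k x) -> dec (gm (w * g) k x).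
Proof.
move=> hm h4 hx; apply: (@gm_bunches 1) => //.
  apply: eq_kdec hm => p q _; rewrite /mg !divn1.
  by rewrite [X in _ && X](_ : _ = (p.2 != q.2) && ((p.1 < k) && (q.1 < k) &&
    ((p.2 < g) && (q.2 < g)))) //; do !bool_congr.
move=> i ig; have -> : minn 1 (g - 1 * i) = 1 by lia.
by rewrite muln1.
Qed.

(** The bunches are the groups of a truncated transversal design on the rows; its blocks, of size 4
    or 5, call for K_4 x K_4 and K_5 x K_4. *)
Lemma gm_trunc n r L x : oa n (fun i => i < 5) L -> 0 < n -> r <= n ->
    dec (mg 4 4) -> dec (mg 5 4) -> dec (gm 3 4 0) ->
    dec (gm (3 * n) 4 x) -> dec (gm (3 * r) 4 x) ->
  dec (gm (3 * (4 * n + r)) 4 x).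
Proof.
move=> hL n0 rn h44 h54 h3 hn hr; apply: (@gm_bunches n) => // [|i ig].
  have K45 k : pred2 4 5 k -> dec (mg k 4) by case/orP=> /eqP->.
  apply: eq_kdec (kdec_mg (kdec_trunc hL n0 rn) K45) => p q _; rewrite /trunc.
  case: (eqVneq p.2 q.2) => [->|_] /=; first by rewrite eqxx !andbF.
  by rewrite -!andbA.
by have [->|->] := minn_trunc n0 rn ig.
Qed.

(** All points of a truncated transversal design get weight 3, and its groups stay unfilled: the
    truncated one becomes the part of size [3 * a]. *)
Lemma gm_oa g a L : oa g (fun i => i < 5) L -> 0 < g -> a <= g ->
  dec (gm 3 4 0) -> dec (gm 3 5 0) -> dec (gm (3 * g) 4 (3 * a)).
Proof.
move=> hL g0 ag h4 h5; have K45 k : pred2 4 5 k -> dec (gm 3 k 0) by case/orP=> /eqP->.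
have := kdec_inflate (kdec_trunc hL g0 ag) K45.
pose S (p : nat * nat) := (p.1 < 4 * g + a) && (p.2 < 3).
apply: (kdec_map (S := S) (f := fun p => (p.1 %/ g, p.1 %% g * 3 + p.2))).
- move=> [x b] [y c] /andP[/= _ b3] /andP[/= _ c3] [exy /mul_add_inj[] // em ->].
  by rewrite (divn_eq x g) exy em -divn_eq.
- by move=> [x b] [y c] _ /and4P[/= ? ? _ /and3P[? ? _]]; rewrite /S /=; split; apply/andP.
- have Sf p : S p -> p.1 %% g * 3 + p.2 < gsize (3 * g) 4 (3 * a) (p.1 %/ g).
    case: p => x b /andP[/= xg b3]; have := ltn_pmod x g0; have dx := divn_eq x g.
    have : x %/ g < 5 by rewrite ltn_divLR //; lia.
    rewrite /gsize; case: ifP => [_|]; first by lia.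
    case: eqP; last by lia.
    by move=> e; move: dx; rewrite e; lia.
  move=> p q pS qS _; rewrite /gm /= !Sf // !andbT /trunc.
  move: pS qS => /andP[-> ->] /andP[-> ->] /=.
  by rewrite andbC; case: (eqVneq p.1 q.1) => [->|_]; rewrite ?eqxx ?andbT.
- have E c t : t < gsize (3 * g) 4 (3 * a) c ->
      exists p, S p /\ (c, t) = (p.1 %/ g, p.1 %% g * 3 + p.2).
    move=> tc; have tg : t %/ 3 < g.
      by rewrite ltn_divLR // mulnC; move: tc; rewrite /gsize; do !case: ifP => //; lia.
    exists (g * c + t %/ 3, t %% 3); rewrite /S /= !divmodMD // ltn_mod -divn_eq andbT.
    split=> //; move: tc; rewrite /gsize; case: ifP => [c4 _|_]; first by nia.
    by case: eqP => // -> ta; have : t %/ 3 < a; [rewrite ltn_divLR // mulnC | lia].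
  by move=> [c t] [d t'] _ /and3P[_ /E[p [pS ->]] /E[q [qS ->]]]; exists p, q.
Qed.

(** * The recursive construction *)

Lemma split_inj (y z w b i j : nat) : y <= z ->
  (if i < y then w + i else w + z + (b + (i - y))) =
  (if j < y then w + j else w + z + (b + (j - y))) -> i = j.
Proof. by case: ltnP => ?; case: ltnP => ?; lia. Qed.

(* The points of a transversal design with groups 0, ..., 5 of size [n] are weighted: those of
   groups 0-3 and the first [r] of group 4 become [3 * g] points of the [g]-groups, the next one of
   group 4 (when [z]) and the first [j] of group 5 become 3, resp. 6 points of the large group. *)
Lemma gm_rec g n r j w (z : bool) L :
    oa n (fun i => [|| i < 4, (i == 4) && (0 < r + z) | (i == 5) && (0 < j)]) L ->
    0 < n -> r + z <= n -> j <= n ->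
    (forall x, x \in [:: 0; 3; 6; 9] -> dec (gm (3 * g) 4 x)) ->
    (forall x, x \in [:: 0; 6] -> dec (gm (3 * g) 5 x)) ->
    dec (gm g (3 * n) w) -> dec (gm g (3 * r) (w + 3 * z)) ->
  dec (gm g (3 * (4 * n + r)) (w + 3 * z + 6 * j)).
Proof.
move=> [ltL cL] n0 rn jn h4 h5 hn hr.
pose k := 3 * (4 * n + r); pose m := w + 3 * z + 6 * j; rewrite -/k -/m.
(* A column is a group of the transversal design; 6 marks the first [w] points of the large part,
   which lie over no group and are shared by all fillings. *)
pose ecol e := if e < w then 6 else if e < w + 3 * z then 4 else 5.
pose col (p : nat * nat) := if p.1 < k then p.1 %/ 3 %/ n else ecol p.2.
pose val (p : nat * nat) := if p.1 < k then p.1 %/ 3 %% n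
  else if p.2 < w + 3 * z then r else (p.2 - (w + 3 * z)) %/ 6.
(* Label 5: pairs covered by the inflated blocks. Label i < 5: pairs inside group [i] or joining it
   to the [w] shared points. Group 5 has no filling, as everything above it belongs to the part of
   size [m]. *)
pose key p q := if [&& col p != col q, col p < 6 & col q < 6] then 5 else minn (col p) (col q).
have colU c a : c < k -> col (c, a) = c %/ 3 %/ n /\ c %/ 3 %/ n < 5.
  by move=> ck; rewrite /col /= ck -divnMA ltn_divLR; move: ck; rewrite /k; lia.
have colE e : col (k, e) = ecol e by rewrite /col ltnn.
have keyU c a d b : c < k -> d < k -> key (c, a) (d, b) =
    if c %/ 3 %/ n == d %/ 3 %/ n then c %/ 3 %/ n else 5.
  move=> /(colU _ a)[ec lc] /(colU _ b)[ed ld]; rewrite /key ec ed.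
  by case: eqVneq => [->|_] /=; rewrite ?minnn ?(leqW lc) ?(leqW ld).
have keyE c a e : c < k -> (key (c, a) (k, e) = if ecol e == 6 then c %/ 3 %/ n
    else if c %/ 3 %/ n == ecol e then ecol e else 5) /\ key (k, e) (c, a) = key (c, a) (k, e).
  move=> /(colU _ a)[ec lc]; rewrite /key ec colE; split; last first.
    by rewrite eq_sym minnC [(ecol e < 6) && _]andbC.
  rewrite /ecol; case ew: (e < w) => /=.
    by rewrite ltnn !andbF; apply/minn_idPl; exact: leq_trans (ltnW lc) _.
  by case: (e < _) => /=; rewrite (leqW lc) andbT; case: eqVneq => //= ->; rewrite minnn.
pose R := gm g k m; rewrite -/R.
have RE p q : p != q -> R p q -> [\/ [/\ p.1 < k, q.1 < k & p.1 != q.1],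
    [/\ p.1 < k, q.1 = k & q.2 < m] | [/\ p.1 = k, q.1 < k & p.2 < m]].
  move=> _ /and3P[pq]; rewrite /gsize; case: (ltnP p.1 k) => pk; case: (ltnP q.1 k) => qk.
  - by constructor 1.
  - by case: (q.1 =P k) => // qk' _ qm; constructor 2.
  - by case: (p.1 =P k) => // pk' pm _; constructor 3.
  - by move: pq; case: (p.1 =P k) => // ->; case: (q.1 =P k) => // ->; rewrite eqxx.
have part i t wi : dec (gm g (3 * t) wi) -> i < 5 -> n * i + t <= 4 * n + r -> t <= n ->
    (forall c, c < k -> c %/ 3 %/ n = i -> c < 3 * (n * i + t)) ->
    (forall e, e < m -> (e < wi) = (ecol e == 6) || (ecol e == i)) -> wi <= m ->
    dec (fun p q => R p q && (key p q == i)).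
  move=> ht i5 tk tn hU hE wm; pose S (p : nat * nat) := p.2 < gsize g (3 * t) wi p.1.
  have ik c : c < 3 * t -> 3 * (n * i) + c < k by rewrite /k; lia.
  have di c : c < 3 * t -> (3 * (n * i) + c) %/ 3 %/ n = i.
    move=> ct; rewrite [3 * _]mulnC divnMDl // mulnC divnMDl // divn_small ?addn0 //.
    by rewrite ltn_divLR // mulnC; lia.
  pose f (p : nat * nat) := (if p.1 < 3 * t then 3 * (n * i) + p.1 else k, p.2).
  have Sk p : S p -> p.1 < 3 * t = false -> p.1 = 3 * t /\ p.2 < wi.
    by rewrite /S /gsize => + pt; rewrite pt; case: eqP.
  apply: (kdec_map (S := S) (f := f)) ht.
  - move=> [c a] [d b] pS qS [/= + <-]; case ct: (c < 3 * t); case dt: (d < 3 * t).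
    + by move/addnI->.
    + by move=> e; have := ik _ ct; rewrite e ltnn.
    + by move=> e; have := ik _ dt; rewrite -e ltnn.
    + by have [/= -> _] := Sk _ pS ct; have [/= -> _] := Sk _ qS dt.
  - by move=> p q _ /and3P[].
  - have Sf p : S p -> (f p).2 < gsize g k m (f p).1.
      move=> pS; rewrite /f /gsize /=; case pt: (p.1 < 3 * t).
        by rewrite ik //; move: pS; rewrite /S /gsize pt.
      by have [_ ?] := Sk _ pS pt; rewrite ltnn eqxx; lia.
    move=> p q pS qS _; rewrite /R /gm !Sf // -[p.2 < _]/(S p) -[q.2 < _]/(S q) pS qS !andbT.
    have eE p' : S p' -> p'.1 < 3 * t = false -> (ecol p'.2 == 6) || (ecol p'.2 == i).
      by move=> pS' pt; have [_ ?] := Sk _ pS' pt; rewrite -hE //; lia.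
    have keyi p' q' : S q' -> p'.1 < 3 * t -> q'.1 < 3 * t = false -> key (f p') (f q') = i.
      move=> qS' pt qt; rewrite /f pt qt; have [-> _] := keyE _ p'.2 q'.2 (ik _ pt).
      by rewrite di //; have := eE _ qS' qt; case: eqP => //= _ /eqP->; rewrite eqxx.
    case pt: (p.1 < 3 * t); case qt: (q.1 < 3 * t).
    + rewrite /f pt qt keyU ?ik // !di // eqxx /= eqn_add2l eqxx andbT.
      by [].
    + rewrite keyi // /f pt qt /= eqxx andbT; have [-> _] := Sk _ qS qt.
      by rewrite !neq_ltn ik // pt.
    + have -> : key (f p) (f q) = i.
        rewrite -(keyi q p) // /f pt qt; by have [_ ->] := keyE _ q.2 p.2 (ik _ qt).
      rewrite /f pt qt /= eqxx andbT; have [-> _] := Sk _ pS pt.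
      by rewrite !neq_ltn ik // qt !orbT.
    + have [-> _] := Sk _ pS pt; have [-> _] := Sk _ qS qt.
      by rewrite /f pt qt /= !eqxx.
  - have EU p : p.1 < k -> p.2 < g -> p.1 %/ 3 %/ n = i -> exists q, S q /\ p = f q.
      case: p => c a /= ck ag ci; have := hU _ ck ci => ct.
      have nc : n * i <= c %/ 3 by rewrite -ci mulnC leq_divM.
      exists (c - 3 * (n * i), a); rewrite /S /f /gsize /=.
      have -> : c - 3 * (n * i) < 3 * t by lia.
      by split=> //; congr pair; have := divn_eq c 3; lia.
    have EE e : e < wi -> exists q, S q /\ (k, e) = f q.
      by move=> ew; exists (3 * t, e); rewrite /S /f /gsize /= ltnn eqxx.
    have Rg p q : R p q -> (p.1 < k -> p.2 < g) /\ (q.1 < k -> q.2 < g).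
      by move=> /and3P[_ pg qg]; split=> h; [move: pg | move: qg]; rewrite /gsize h.
    move=> p q pq /andP[Rpq kpq]; have [pg qg] := Rg _ _ Rpq.
    have i5' : (5 == i) = false by apply/negbTE; rewrite neq_ltn i5 orbT.
    case: (RE _ _ pq Rpq) => [[pk qk _]|[pk qk qm]|[pk qk pm]].
    + move: kpq; rewrite [p]surjective_pairing [q]surjective_pairing keyU //.
      case: ifP => [/eqP epq /eqP ei|_]; last by rewrite i5'.
      have [p' [pS ->]] := EU _ pk (pg pk) ei; rewrite epq in ei.
      by have [q' [qS ->]] := EU _ qk (qg qk) ei; exists p', q'.
    + have eq' : q = (k, q.2) by rewrite -qk -surjective_pairing.
      move: kpq; rewrite {1}[p]surjective_pairing eq'; have [-> _] := keyE _ p.2 q.2 pk.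
      have := hE _ qm; case: ifP => /= [_ qw /eqP ei|_].
        have [p' [pS ->]] := EU _ pk (pg pk) ei; have [q' [qS ->]] := EE _ qw.
        by exists p', q'.
      case: ifP => [/eqP ep qw /eqP ei|_ _]; last by rewrite i5'.
      rewrite ei eqxx in qw; rewrite ei in ep.
      have [p' [pS ->]] := EU _ pk (pg pk) ep; have [q' [qS ->]] := EE _ qw.
      by exists p', q'.
    + have ep' : p = (k, p.2) by rewrite -pk -surjective_pairing.
      move: kpq; rewrite {1}[q]surjective_pairing ep'.
      have [e1 ->] := keyE _ q.2 p.2 qk; rewrite e1.
      have := hE _ pm; case: ifP => /= [_ pw /eqP ei|_].
        have [q' [qS ->]] := EU _ qk (qg qk) ei; have [p' [pS ->]] := EE _ pw.
        by exists p', q'.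
      case: ifP => [/eqP eq pw /eqP ei|_ _]; last by rewrite i5'.
      rewrite ei eqxx in pw; rewrite ei in eq.
      have [q' [qS ->]] := EU _ qk (qg qk) eq; have [p' [pS ->]] := EE _ pw.
      by exists p', q'.
have kw : w <= m by rewrite /m; lia.
have wm : w + 3 * z <= m by rewrite /m; lia.
have part4 i : i < 4 -> dec (fun p q => R p q && (key p q == i)).
  move=> i4; have ni : n * i <= n * 3 by rewrite leq_mul2l -ltnS i4 orbT.
  apply: (part i n w) => //; [exact: leqW | by lia | move=> c _ <- | move=> e _].
    have := ltn_ceil (c %/ 3) n0; have := @ltn_ceil c 3 isT.
    by rewrite !mulSn [_ %/ n * n]mulnC; lia.
  have e4 : (4 == i) = false by lia.
  have e5 : (5 == i) = false by lia.
  by rewrite /ecol; case: ifP => //= _; case: ifP => _ /=; rewrite ?e4 ?e5.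
have part5 : dec (fun p q => R p q && (key p q == 4)).
  have rn' : r <= n by apply: leq_trans rn; apply: leq_addr.
  apply: (part 4 r (w + 3 * z)) => //; [by lia | by move=> c ck _; move: ck; rewrite /k; lia |].
  move=> e _; rewrite /ecol; case: (ltnP e w) => ew; last by case: ifP.
  by rewrite (leq_trans ew) // leq_addr.
apply: (kdec_key (s := iota 0 6) (k := key)); first exact: iota_uniq.
  move=> i; rewrite mem_iota => /andP[_ i6].
  have [/part4//|i4] := ltnP i 4.
  have [->//|i4'] := eqVneq i 4.
  have -> : i = 5 by lia.
  pose C i := [|| i < 4, (i == 4) && (0 < r + z) | (i == 5) && (0 < j)].
  have colC p q : p != q -> R p q -> key p q == 5 ->
      [/\ C (col p), C (col q), col p != col q & (val p < n) && (val q < n)].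
    move=> pq Rpq kpq.
    have CU c a : c < k -> C (col (c, a)) && (val (c, a) < n).
      move=> ck; have [ec lc] := colU _ a ck; rewrite ec /val /= ck ltn_mod n0 andbT /C.
      case: (ltnP _ 4) => //= c4; have e4 : c %/ 3 %/ n = 4 by lia.
      rewrite e4 eqxx /=; apply/orP; left; rewrite addn_gt0; apply/orP; left.
      move: ck; rewrite /k mulnC -ltn_divLR // => ck.
      by have := leq_divM (c %/ 3) n; rewrite e4; lia.
    have CE e : e < m -> ecol e != 6 -> C (ecol e) && (val (k, e) < n).
      move=> em; rewrite /ecol /val /= ltnn /C; case: ifP => //= ew _; case: ifP => ez /=.
        by rewrite ?orbF; apply/andP; split; lia.
      have : (e - (w + 3 * z)) %/ 6 < j by rewrite ltn_divLR //; move: em; rewrite /m; lia.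
      by move=> ej; rewrite (leq_ltn_trans _ (leq_trans ej jn)) // andbT; lia.
    have U5 t : t.1 < k -> col t < 5.
      by move=> tk; rewrite [t]surjective_pairing; have [-> ] := colU _ t.2 tk.
    have /and3P[cpq cp cq] : [&& col p != col q, col p < 6 & col q < 6].
      move: kpq; rewrite /key; case: ifP => // _ /eqP e5.
      have : col p < 5 \/ col q < 5.
        by case: (RE _ _ pq Rpq) => [[/U5 ? _ _]|[/U5 ? _ _]|[_ /U5 ? _]]; [left | left | right].
      by move: e5; lia.
    have CUt t : t.1 < k -> C (col t) && (val t < n).
      by move=> tk; have := CU _ t.2 tk; rewrite -surjective_pairing.
    have CEt t : t.1 = k -> t.2 < m -> col t < 6 -> C (col t) && (val t < n).
      case: t => _ e /= -> em; rewrite colE => e6; apply: CE => //.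
      by rewrite neq_ltn e6.
    have [/andP[Cp vp] /andP[Cq vq]] : C (col p) && (val p < n) /\ C (col q) && (val q < n).
      by case: (RE _ _ pq Rpq) => [[? ? _]|[? ? ?]|[? ? ?]]; split; [exact: CUt | exact: CUt |
        exact: CUt | exact: CEt | exact: CEt | exact: CUt].
    by rewrite vp vq.
  apply: (kdec_sum (s := L) (Q := fun l p q => [&& R p q && (key p q == 5),
    nth 0 l (col p) == val p & nth 0 l (col q) == val q])); last first.
    move=> p q pq; have [/andP[Rpq kpq]|nR] := boolP (R p q && (key p q == 5)); last by rewrite big1.
    have [Cp Cq cpq /andP[vp vq]] := colC _ _ pq Rpq kpq.
    by rewrite /= -(cL _ _ _ _ Cp Cq cpq vp vq) -sum1_count [RHS]big_mkcond.
  move=> l lL; have ll i : C i -> nth 0 l i < n := ltL l i lL.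
  (* What the row meets in its last two columns: a point of full weight ([u]), the point of weight 3
     ([zz]), a point of weight 6 ([ee]). A column outside [C] may hold any value, but then [r] and
     [z], or [j], vanish, and the flags for that column are false. *)
  pose u := nth 0 l 4 < r; pose zz := z && (nth 0 l 4 == r); pose ee := nth 0 l 5 < j.
  pose K := 4 + u; pose X := 3 * zz + 6 * ee.
  have lc c : c < K -> nth 0 l c < n /\ n * c + nth 0 l c < 4 * n + r.
    move=> cK; have [c4|c4] := ltnP c 4.
      have lcn : nth 0 l c < n by apply: ll; rewrite /C c4.
      by split=> //; have : n * c <= n * 3 by [rewrite leq_mul2l -ltnS c4 orbT]; lia.
    have uT : u by move: cK; rewrite /K; case: (u) => //; lia.
    have -> : c = 4 by move: cK; rewrite /K uT; lia.
    by move: uT; rewrite /u => ur; split; lia.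
  (* A fifth point of full weight excludes the point of weight 3, so with five groups [X] is 0 or
     6. *)
  have hX : dec (gm (3 * g) K X).
    rewrite /K /X; case uE: u; last by apply: h4; case: (zz); case: (ee).
    apply: h5; have -> : zz = false; last by case: (ee).
    by apply/negbTE; rewrite negb_and; apply/orP; right; move: uE; rewrite /u; lia.
  (* A point of full weight is three consecutive parts of size [g]: position [p.2] is place
     [p.2 %/ 3] in the one numbered [p.2 %% 3]. *)
  pose f (p : nat * nat) := if p.1 < K then (3 * (n * p.1 + nth 0 l p.1) + p.2 %% 3, p.2 %/ 3)
    else (k, if p.2 < 3 * zz then w + p.2 else w + 3 * z + (nth 0 l 5 * 6 + (p.2 - 3 * zz))).
  pose S (p : nat * nat) := p.2 < gsize (3 * g) K X p.1.
  have fU p : p.1 < K -> [/\ (f p).1 < k, col (f p) = p.1 & val (f p) = nth 0 l p.1].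
    move=> pK; have [ln lk] := lc _ pK; have a3 := @ltn_pmod p.2 3 isT.
    have fk : (f p).1 < k by rewrite /f pK /= /k; lia.
    have f3 : (f p).1 %/ 3 = n * p.1 + nth 0 l p.1.
      by rewrite /f pK /= [3 * _]mulnC divnMDl // divn_small // addn0.
    by rewrite /col /val fk f3 !divmodMD.
  have fE p : S p -> p.1 < K = false -> [/\ p.1 = K, (f p).1 = k, (f p).2 < m,
      4 < K -> col (f p) = 5 & 4 <= col (f p) < 6 /\ nth 0 l (col (f p)) = val (f p)].
    rewrite /S /gsize => + pK; rewrite pK; case: eqP => // e pX.
    rewrite /f /col /val pK /= ltnn /ecol.
    case a3: (p.2 < 3 * zz).
      have zzT : zz by move: a3; case: (zz).
      have /andP[zT /eqP lr] := zzT.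
      have h1 : (w + p.2 < w) = false by lia.
      have h2 : w + p.2 < w + 3 * z by move: a3; rewrite zzT zT ltn_add2l.
      split=> //; first by apply: leq_trans h2 wm.
        by rewrite /K /u lr ltnn.
      by rewrite h1 h2.
    set d := p.2 - 3 * zz; have eeT : ee by move: pX; rewrite /X; case: (ee) => //; lia.
    have d6 : d < 6 by move: pX; rewrite /X eeT /d; lia.
    have -> : w + 3 * z + (nth 0 l 5 * 6 + d) < w = false by lia.
    have -> : w + 3 * z + (nth 0 l 5 * 6 + d) < w + 3 * z = false by lia.
    split=> //; first by move: eeT; rewrite /ee /m; lia.
    by rewrite addKn divnMDl // divn_small ?addn0.
  have fR p q : S p -> S q -> p != q -> R (f p) (f q) && (key (f p) (f q) == 5) = (p.1 != q.1).
    have fS t : S t -> (f t).2 < gsize g k m (f t).1.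
      move=> tS; rewrite /gsize; case tK: (t.1 < K).
        have [-> _ _] := fU _ tK; rewrite /f tK /= ltn_divLR // mulnC.
        by move: tS; rewrite /S /gsize tK.
      by have [_ -> ? _ _] := fE _ tS tK; rewrite ltnn eqxx.
    have K5 : K <= 5 by rewrite /K -addn1 -[5]/(4 + 1) addn1 leq_add2l leq_b1.
    have ltc t t' : t.1 < K -> (4 < K -> col (f t') = 5) -> 4 <= col (f t') -> t.1 < col (f t').
      move=> tK; case: (ltnP 4 K) => [_ /(_ isT) -> _|K4 _]; first exact: leq_trans tK K5.
      by apply: leq_trans; apply: leq_trans tK K4.
    move=> pS qS pq; rewrite /R /gm !fS // !andbT /key.
    case pK: (p.1 < K); case qK: (q.1 < K).
    - have [pk -> _] := fU _ pK; have [qk -> _] := fU _ qK.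
      have p6 : p.1 < 6 := leq_trans pK (leqW K5).
      have q6 : q.1 < 6 := leq_trans qK (leqW K5).
      rewrite p6 q6 !andbT; have [e|ne] := eqVneq p.1 q.1; rewrite /= ?eqxx ?andbT.
        by rewrite e minnn andbC (ltn_eqF (leq_trans qK K5)).
      have [_ _ vp] := fU _ pK.
      apply: contra_neq ne => ef; have [_ cp _] := fU _ pK; have [_ cq _] := fU _ qK.
      by rewrite -cp -cq /col ef; move: qk; case: ifP.
    - have [pk -> _] := fU _ pK; have [qk fq _ c5 [/andP[c4 c6] _]] := fE _ qS qK.
      rewrite fq neq_ltn pk /= qk (leq_trans pK (leqW K5)) c6.
      by rewrite neq_ltn ltc //= neq_ltn pK.
    - have [qk -> _] := fU _ qK; have [pk fp _ c5 [/andP[c4 c6] _]] := fE _ pS pK.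
      rewrite fp neq_ltn qk orbT /= pk (leq_trans qK (leqW K5)) c6.
      by rewrite neq_ltn ltc ?orbT //= neq_ltn qK orbT.
    - have [-> -> _ _ _] := fE _ pS pK; have [-> -> _ _ _] := fE _ qS qK.
      by rewrite !eqxx.
  apply: (kdec_map (S := S) (f := f)) hX.
  - move=> p q pS' qS' ef; have pS : S p := pS'; have qS : S q := qS'.
    have [//|pq] := eqVneq p q.
    have := fR p q pS qS pq; rewrite ef /R /gm eqxx /= => /esym/negbT; rewrite negbK => /eqP e.
    move: ef; rewrite /f -e; case pK: (p.1 < K).
      by case=> /addnI em ed; move: pq; rewrite [p]surjective_pairing [q]surjective_pairing
        -e (divn_eq p.2 3) (divn_eq q.2 3) em ed eqxx.
    have [p1 _ _ _ _] := fE _ pS pK; have pX : p.2 < X by move: pS; rewrite /S /gsize p1 ltnn eqxx.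
    have qX : q.2 < X by move: qS; rewrite /S /gsize -e p1 ltnn eqxx.
    case=> ea; move: pq; rewrite [p]surjective_pairing [q]surjective_pairing -e.
    have l5 : zz <= z by rewrite /zz; case: (z) => //=; apply: leq_b1.
    have zX : 3 * zz <= 3 * z by rewrite leq_mul2l l5.
    by rewrite (split_inj zX ea).
  - by move=> p q _ /and3P[].
  - move=> p q pS qS pq; rewrite fR // -[RHS]/[&& _, S p & S q] pS qS !andbT.
    have vE t : S t -> nth 0 l (col (f t)) == val (f t).
      move=> tS; case tK: (t.1 < K); first by have [_ -> ->] := fU _ tK.
      by have [_ _ _ _ [_ ->]] := fE _ tS tK.
    by rewrite !vE // !andbT.
  - move=> p q pq /and3P[/andP[Rpq kpq] /eqP lp /eqP lq].
    have [Cp Cq _ _] := colC _ _ pq Rpq kpq.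
    have XU t : t.1 < k -> t.2 < g -> nth 0 l (col t) = val t -> exists t', S t' /\ t = f t'.
      case: t => c a /= ck ag; have [ec lc5] := colU _ a ck; rewrite ec /val /= ck => lv.
      have dc := divn_eq (c %/ 3) n.
      have qK : c %/ 3 %/ n < K.
        rewrite /K /u; have [q4|q4] := ltnP (c %/ 3 %/ n) 4; first by apply: leq_trans q4 (leq_addr _ _).
        have q4' : c %/ 3 %/ n = 4 by apply/eqP; rewrite eqn_leq q4 andbT -ltnS.
        have h : c %/ 3 < 4 * n + r by rewrite ltn_divLR // mulnC.
        have e4 : 4 * n + c %/ 3 %% n = c %/ 3 by rewrite -q4' -dc.
        have cr : c %/ 3 %% n < r by rewrite -(ltn_add2l (4 * n)) e4.
        by move: lv; rewrite q4' => ->; rewrite cr.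
      exists (c %/ 3 %/ n, a * 3 + c %% 3); rewrite /S /f /gsize /= qK lv.
      have c3 := ltn_pmod c (isT : 0 < 3).
      rewrite modnMDl modn_mod divnMDl // (divn_small c3) addn0; split; first exact: mul_add_ltn.
      by congr pair; rewrite [n * _]mulnC -dc [3 * _]mulnC -divn_eq.
    have XE e : e < m -> ecol e != 6 -> nth 0 l (ecol e) = val (k, e) ->
        exists t', S t' /\ (k, e) = f t'.
      rewrite /ecol /val /= ltnn => em; case: ifP => // ew _; case: ifP => ez lv.
        have zT : z by move: ez; case: (z) => //; rewrite muln0 addn0 ew.
        have zzT : zz by rewrite /zz zT lv eqxx.
        exists (K, e - w); rewrite /S /f /gsize /= !ltnn eqxx /X zzT.
        have we : w <= e by rewrite leqNgt ew.
        have a3 : e - w < 3 by rewrite ltn_subLR //; move: ez; rewrite zT.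
        rewrite a3; split; first exact: leq_trans a3 (leq_addr _ _).
        by rewrite subnKC.
      have we : w + 3 * z <= e by rewrite leqNgt ez.
      have ej : nth 0 l 5 < j by rewrite lv ltn_divLR // ltn_subLR // [j * 6]mulnC.
      have eeT : ee := ej.
      set d := e - (w + 3 * z) in lv *; have d6 := ltn_pmod d (isT : 0 < 6).
      exists (K, 3 * zz + d %% 6); rewrite /S /f /gsize /= !ltnn eqxx /X eeT.
      have -> : (3 * zz + d %% 6 < 3 * zz) = false by rewrite ltnNge leq_addr.
      by rewrite ltn_add2l; split=> //; rewrite addKn lv -divn_eq subnKC.
    have gt t : t.2 < gsize g k m t.1 -> t.1 < k -> t.2 < g by rewrite /gsize => + tk; rewrite tk.
    have /and3P[_ /gt gp /gt gq] := Rpq.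
    have XEt t : t.1 = k -> t.2 < m -> C (col t) -> nth 0 l (col t) = val t ->
        exists t', S t' /\ t = f t'.
      case: t => _ e /= -> em; rewrite colE => Ce lv; apply: XE => //.
      by apply: contraTneq Ce => ->.
    have [[p' [pS ->]] [q' [qS ->]]] :
        (exists t', S t' /\ p = f t') /\ (exists t', S t' /\ q = f t').
      by case: (RE _ _ pq Rpq) => [[pk qk _]|[pk qk qm]|[pk qk pm]]; split;
        by [apply: XEt | apply: XU => //; auto].
    by exists p', q'.
move=> p q pq Rpq; rewrite mem_iota /= add0n /key; case: ifP => // _.
have U5 t : t.1 < k -> col t < 5.
  by move=> tk; rewrite [t]surjective_pairing; have [-> ] := colU _ t.2 tk.
case: (RE _ _ pq Rpq) => [[/U5 c5 _ _]|[/U5 c5 _ _]|[_ /U5 c5 _]];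
  by rewrite gtn_min (leqW c5) ?orbT.
Qed.

(** * Orthogonal arrays *)

Lemma oa_sub n (C C' : pred nat) L : (forall i, C' i -> C i) -> oa n C L -> oa n C' L.
Proof. by move=> sC [h1 h2]; split=> [r i rL /sC|i j x y /sC ? /sC]; [apply: h1 | apply: h2]. Qed.

(** Counting: [n * n] rows with distinct pairs in two columns realise all [n * n] pairs, each
    once. *)
Lemma oa_uniq n (C : pred nat) L :
    (forall r i, r \in L -> C i -> nth 0 r i < n) -> size L = n * n ->
    (forall i j, C i -> C j -> i < j -> uniq [seq (nth 0 r i, nth 0 r j) | r <- L]) ->
  oa n C L.
Proof.
move=> ltL sL uL; split=> // i j x y Ci Cj ij xn yn.
wlog lij : i j x y Ci Cj ij xn yn / i < j.
  move=> hw; move: (ij); rewrite neq_ltn => /orP[ltij|ltji]; first exact: hw.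
  by rewrite -(hw j i y x) 1?eq_sym //; apply: eq_count => r; rewrite andbC.
pose s := [seq (nth 0 r i, nth 0 r j) | r <- L].
pose t := [seq (a, b) | a <- iota 0 n, b <- iota 0 n].
have us : uniq s := uL i j Ci Cj lij.
have st : {subset s <= t}.
  move=> _ /mapP[r rL ->]; apply/allpairsP; exists (nth 0 r i, nth 0 r j).
  by rewrite !mem_iota /= !ltL.
have [_ est] : (size s = size t) * (s =i t).
  by apply: uniq_min_size us st _; rewrite size_allpairs !size_iota size_map sL.
have : count_mem (x, y) s = 1.
  rewrite count_uniq_mem // est; apply/eqP; rewrite eqb1; apply/allpairsP; exists (x, y).
  by rewrite !mem_iota.
by rewrite count_map => <-; apply: eq_count => r /=; rewrite xpair_eqE.
Qed.

(** The lines y = ai + b over the integers mod [n], read at i = 0, ..., 4; the sixth column is the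
    slope. *)
Definition cyclic_oa n : seq (seq nat) :=
  [seq mkseq (fun i => if i < 5 then (a * i + b) %% n else a) 6 | a <- iota 0 n, b <- iota 0 n].

(** The indices of two of the first five columns differ by at most 4, and 1, ..., 4 are invertible
    mod [n] when [n] is prime to 6; hence two values determine the slope. *)
Lemma oa_cyclic n : 0 < n -> coprime n 6 -> oa n (fun i => i < 6) (cyclic_oa n).
Proof.
move=> n0 n6.
have cop d : 0 < d < 5 -> coprime n d.
  have [n2 n3] : coprime n 2 /\ coprime n 3 by apply/andP; rewrite -coprimeMr.
  by case: d => [|[|[|[|[|]]]]] // _; rewrite ?coprimen1 // (coprimeMr n 2 2) n2.
have inj a a' b b' i j : i < j -> j < 5 -> a < n -> a' < n ->
    a * i + b = a' * i + b' %[mod n] -> a * j + b = a' * j + b' %[mod n] -> a = a'.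
  wlog leaa : a a' b b' / a <= a'.
    move=> hw ij j5 an a'n ei ej; have [?|/ltnW ?] := leqP a a'; first exact: (hw _ _ b b').
    by apply/esym; apply: (hw _ _ b' b).
  move=> ij j5 an a'n ei ej; pose d := j - i.
  (* Adding crosswise avoids truncated subtraction: once common terms are cancelled, [a * d] and
     [a' * d] are congruent mod [n]. *)
  have : (a * j + b) + (a' * i + b') = (a' * j + b') + (a * i + b) %[mod n].
    by rewrite -modnDm ej -ei modnDm.
  have -> : a * j + b + (a' * i + b') = (a + a') * i + b + b' + a * d.
    by rewrite -(subnKC (ltnW ij)) -/d; nia.
  have -> : a' * j + b' + (a * i + b) = (a + a') * i + b + b' + a' * d.
    by rewrite -(subnKC (ltnW ij)) -/d; nia.
  move/eqP; rewrite eqn_modDl eq_sym eqn_mod_dvd ?leq_mul2r ?leaa ?orbT //.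
  have d5 : 0 < d < 5 by rewrite /d; lia.
  rewrite -mulnBl Gauss_dvdl ?cop // => dv; have [?|p] := posnP (a' - a); first by lia.
  by have := dvdn_leq p dv; lia.
have nthE a b i : i < 6 -> nth 0 (mkseq (fun i => if i < 5 then (a * i + b) %% n else a) 6) i =
    if i < 5 then (a * i + b) %% n else a by move=> i6; rewrite nth_mkseq.
have inj5 a a' b b' i : b < n -> b' < n -> a = a' ->
    (a * i + b) %% n = (a' * i + b') %% n -> b = b'.
  by move=> bn b'n -> /eqP; rewrite eqn_modDl !modn_small // => /eqP.
apply: oa_uniq.
- move=> _ i /allpairsP[[a b] /= [+ _ ->]] i6; rewrite mem_iota nthE // => /= an.
  by case: ifP; rewrite ?ltn_mod.
- by rewrite size_allpairs !size_iota.
- move=> i j i6 j6 ij; have i5 : i < 5 by lia.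
  rewrite /cyclic_oa map_allpairs; apply: allpairs_uniq; rewrite ?iota_uniq //.
  move=> _ _ /allpairsP[[a b] /= [+ + ->]] /allpairsP[[a' b'] /= [+ + ->]].
  rewrite !mem_iota /= !nthE // i5 => an bn a'n b'n [ei].
  have [j5 ej|j5 ea] := ltnP j 5; last by rewrite ea (inj5 _ _ _ _ _ bn b'n ea ei).
  have ea := inj _ _ _ _ _ _ ij j5 an a'n ei ej.
  by rewrite ea (inj5 _ _ _ _ _ bn b'n ea ei).
Qed.

Lemma count_allpairs (S U : Type) (T : eqType) (f : S -> T -> U) (P : pred S) (Q : pred T)
    (R : pred U) s t : (forall x y, y \in t -> R (f x y) = P x && Q y) ->
  count R [seq f x y | x <- s, y <- t] = count P s * count Q t.
Proof.
move=> eR; elim: s => //= x s IHs; rewrite count_cat IHs mulnDl count_map; congr (_ + _).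
case Px: (P x); rewrite ?mul1n ?mul0n.
  by apply: eq_in_count => y yt /=; rewrite eR ?Px.
by rewrite -(count_pred0 t); apply: eq_in_count => y yt /=; rewrite eR ?Px.
Qed.

(** MacNeish's product: entries are paired in mixed radix, so a condition on two columns splits into
    one for each factor. *)
Lemma oa_mul n n' k L L' : 0 < n' -> oa n (fun i => i < k) L -> oa n' (fun i => i < k) L' ->
  exists L'', oa (n * n') (fun i => i < k) L''.
Proof.
move=> n'0 [lt1 c1] [lt2 c2].
pose h (r r' : seq nat) := mkseq (fun i => nth 0 r i * n' + nth 0 r' i) k.
exists [seq h r r' | r <- L, r' <- L']; split.
  move=> _ i /allpairsP[[r r'] /= [rL rL' ->]] ik; rewrite nth_mkseq //.
  have := lt1 _ _ rL ik; have := lt2 _ _ rL' ik; move=> h2 h1.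
  apply: leq_trans (_ : (nth 0 r i).+1 * n' <= _); first by rewrite mulSnr ltn_add2l.
  by rewrite leq_mul2r h1 orbT.
move=> i j x y ik jk ij xn yn.
have := c1 i j (x %/ n') (y %/ n') ik jk ij; rewrite !ltn_divLR // => /(_ xn yn) e1.
have := c2 i j (x %% n') (y %% n') ik jk ij; rewrite !ltn_mod => /(_ n'0 n'0) e2.
have eqm b z u : b < n' -> (u * n' + b == z) = (u == z %/ n') && (b == z %% n').
  move=> bn; apply/eqP/andP => [<-|[/eqP-> /eqP->]]; last by rewrite -divn_eq.
  by rewrite divnMDl // divn_small // addn0 modnMDl modn_small.
rewrite -[RHS]/(1 * 1) -[X in X * _]e1 -[X in _ * X]e2; apply: count_allpairs => r r' rL'.
by rewrite /h !nth_mkseq // !eqm ?lt2 // andbACA.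
Qed.

(** * Orthogonal arrays from difference matrices *)

Section Tables.
Local Open Scope N_scope.

(* Addition of the group [Z_m1 x Z_m2 x ...], whose elements are coded in mixed radix. *)
Fixpoint addm (ms : seq N) (x y : N) : N :=
  if ms is m :: ms' then (x mod m + y mod m) mod m + m * addm ms' (x / m) (y / m) else 0.

(* The rows of [D] are those of a difference matrix over this group. *)
Definition dm_oa ms (D : seq (seq N)) : seq (seq N) :=
  flatten [seq [seq rcons [seq addm ms (nth 0 d a) (N.of_nat b) | d <- D] (N.of_nat a)
    | b <- iota 0 (size (head [::] D))] | a <- iota 0 (size (head [::] D))].

Definition check_oa (n k : nat) (L : seq (seq N)) :=
  all (fun i => all (fun j => (sort lexle [seq (nth 0 r i, nth 0 r j) | r <- L] ==
    [seq (x, y) | x <- points n, y <- points n])) (iota i.+1 (k - i.+1))) (iota 0 k).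

Lemma check_oaP n k L : (1 < k)%nat -> check_oa n k L ->
  oa n (fun i => (i < k)%nat) [seq map N.to_nat r | r <- L].
Proof.
move=> k1 /allP ch.
have nthE (r : seq N) i : nth 0%nat (map N.to_nat r) i = N.to_nat (nth 0 r i).
  have [ir|ir] := ltnP i (size r); first by rewrite (nth_map 0).
  by rewrite !nth_default ?size_map.
have pP i j : (i < j < k)%nat -> perm_eq [seq (nth 0 r i, nth 0 r j) | r <- L]
    [seq (x, y) | x <- points n, y <- points n].
  move=> /andP[ij jk]; have /ch/allP : i \in iota 0 k by rewrite mem_iota; lia.
  move/(_ j); rewrite mem_iota => /(_ _)/eqP <-; last by lia.
  by rewrite perm_sym perm_sort.
have pts x : (x < n)%nat -> N.of_nat x \in points n by rewrite mem_points ltbE Nnat.Nat2N.id.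
have cnt i j x y : (i < j < k)%nat -> (x < n)%nat -> (y < n)%nat ->
    count (fun r => (nth 0%nat r i == x) && (nth 0%nat r j == y)) [seq map N.to_nat r | r <- L] = 1%nat.
  move=> ijk xn yn; have /permP/(_ (pred1 (N.of_nat x, N.of_nat y))) := pP _ _ ijk.
  have -> : count_mem (N.of_nat x, N.of_nat y) [seq (x, y) | x <- points n, y <- points n] = 1%nat.
    have up := uniq_points n.
    rewrite count_uniq_mem ?allpairs_uniq //; last by case=> ? ? [? ?].
    by apply/eqP; rewrite eqb1; apply/allpairsP; exists (N.of_nat x, N.of_nat y); rewrite !pts.
  rewrite !count_map => <-; apply: eq_count => r /=; rewrite !nthE xpair_eqE.
  by congr (_ && _); apply/eqP/eqP => [<-|->]; rewrite ?Nnat.N2Nat.id ?Nnat.Nat2N.id.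
split=> [_ i /mapP[r rL ->] ik|i j x y ik jk ij xn yn].
  (* The check concerns pairs only, so an entry is bounded through a second column: column 1 for
     column 0, and column 0 for the others. *)
  rewrite nthE -ltbE -mem_points; have [i0|i0] := posnP i.
    have : (nth 0 r i, nth 0 r 1) \in [seq (x, y) | x <- points n, y <- points n].
      have h : (0 < 1 < k)%nat by [].
      by rewrite -(perm_mem (pP _ _ h)) i0 (map_f (fun r => (nth 0 r 0, nth 0 r 1))).
    by case/allpairsP=> -[x y] /= [xp _ [->]].
  have : (nth 0 r 0, nth 0 r i) \in [seq (x, y) | x <- points n, y <- points n].
    have h : (0 < i < k)%nat by rewrite i0.
    by rewrite -(perm_mem (pP _ _ h)) (map_f (fun r => (nth 0 r 0, nth 0 r i))).
  by case/allpairsP=> -[x y] /= [_ yp [_ ->]].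
have [lij|lji] : (i < j)%nat \/ (j < i)%nat by lia.
  by apply: cnt; rewrite ?lij.
by rewrite -(cnt j i y x) ?lji //; apply: eq_count => r; rewrite andbC.
Qed.

(** Each row of the matrix is multiplication by an element of the field with 4 elements. Orders 8, 9
    and 16 are obtained in the same way, with five field elements. *)
Lemma oa_4 : exists L, oa 4 (fun i => i < 5)%nat L.
Proof.
eexists; apply: (@check_oaP 4 5 (dm_oa [:: 2; 2]
  [:: [:: 0; 0; 0; 0];
    [:: 0; 1; 2; 3];
    [:: 0; 2; 3; 1];
    [:: 0; 3; 1; 2]]) isT).
by vm_compute.
Qed.

Lemma oa_8 : exists L, oa 8 (fun i => i < 6)%nat L.
Proof.
eexists; apply: (@check_oaP 8 6 (dm_oa [:: 2; 2; 2]
  [:: [:: 0; 0; 0; 0; 0; 0; 0; 0];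
    [:: 0; 1; 2; 3; 4; 5; 6; 7];
    [:: 0; 2; 4; 6; 3; 1; 7; 5];
    [:: 0; 3; 6; 5; 7; 4; 1; 2];
    [:: 0; 4; 3; 7; 6; 2; 5; 1]]) isT).
by vm_compute.
Qed.

Lemma oa_9 : exists L, oa 9 (fun i => i < 6)%nat L.
Proof.
eexists; apply: (@check_oaP 9 6 (dm_oa [:: 3; 3]
  [:: [:: 0; 0; 0; 0; 0; 0; 0; 0; 0];
    [:: 0; 1; 2; 3; 4; 5; 6; 7; 8];
    [:: 0; 2; 1; 6; 8; 7; 3; 5; 4];
    [:: 0; 3; 6; 4; 7; 1; 8; 2; 5];
    [:: 0; 4; 8; 7; 2; 3; 5; 6; 1]]) isT).
by vm_compute.
Qed.

Lemma oa_16 : exists L, oa 16 (fun i => i < 6)%nat L.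
Proof.
eexists; apply: (@check_oaP 16 6 (dm_oa [:: 2; 2; 2; 2]
  [:: [:: 0; 0; 0; 0; 0; 0; 0; 0; 0; 0; 0; 0; 0; 0; 0; 0];
    [:: 0; 1; 2; 3; 4; 5; 6; 7; 8; 9; 10; 11; 12; 13; 14; 15];
    [:: 0; 2; 4; 6; 8; 10; 12; 14; 3; 1; 7; 5; 11; 9; 15; 13];
    [:: 0; 3; 6; 5; 12; 15; 10; 9; 11; 8; 13; 14; 7; 4; 1; 2];
    [:: 0; 4; 8; 12; 3; 7; 11; 15; 6; 2; 14; 10; 5; 1; 13; 9]]) isT).
by vm_compute.
Qed.

Lemma oa_12 : exists L, oa 12 (fun i => i < 5)%nat L.
Proof.
eexists; apply: (@check_oaP 12 5 (dm_oa [:: 6; 2]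
  [:: [:: 0; 0; 0; 0; 0; 0; 0; 0; 0; 0; 0; 0];
    [:: 0; 1; 2; 3; 4; 5; 6; 7; 8; 9; 10; 11];
    [:: 0; 6; 11; 7; 5; 1; 10; 2; 4; 3; 9; 8];
    [:: 0; 11; 7; 1; 3; 8; 2; 10; 9; 4; 6; 5]]) isT).
by vm_compute.
Qed.

Lemma oa_24 : exists L, oa 24 (fun i => i < 5)%nat L.
Proof.
eexists; apply: (@check_oaP 24 5 (dm_oa [:: 12; 2]
  [:: [:: 0; 0; 0; 0; 0; 0; 0; 0; 0; 0; 0; 0; 0; 0; 0; 0; 0; 0; 0; 0; 0; 0; 0; 0];
    [:: 0; 1; 2; 3; 4; 5; 6; 7; 8; 9; 10; 11; 12; 13; 14; 15; 16; 17; 18; 19; 20; 21; 22; 23];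
    [:: 0; 13; 9; 17; 6; 21; 14; 22; 11; 5; 7; 18; 10; 23; 3; 2; 20; 16; 19; 12; 1; 15; 4; 8];
    [:: 0; 14; 19; 21; 23; 1; 20; 6; 10; 18; 2; 8; 13; 11; 5; 7; 3; 12; 16; 22; 4; 9; 15; 17]]) isT).
by vm_compute.
Qed.

End Tables.

Definition oa5 n := exists L, oa n (fun i => i < 5) L.

Lemma oa5_mul n n' : 0 < n' -> oa5 n -> oa5 n' -> oa5 (n * n').
Proof. by move=> n0 [L hL] [L' hL']; apply: oa_mul hL hL'. Qed.

Lemma oa5_coprime n : 0 < n -> coprime n 6 -> oa5 n.
Proof. by move=> n0 n6; eexists; apply: oa_sub (oa_cyclic n0 n6) => i /leqW. Qed.

Lemma coprime6 n : coprime n 6 = (n %% 6 == 1) || (n %% 6 == 5).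
Proof.
rewrite -coprime_modl; have := ltn_pmod n (isT : 0 < 6).
by case: (n %% 6) => [|[|[|[|[|[|]]]]]].
Qed.

(** A power of 2 that is at least 4 is a product of factors 4 and at most one 8; the cofactor is
    prime to 6. *)
Lemma oa5_4dvd n : 0 < n -> 4 %| n -> n %% 3 != 0 -> oa5 n.
Proof.
elim/ltn_ind: n => n IH n0 /dvdnP[q nq] n3; have [q0 qn] : 0 < q /\ q < n by lia.
have [q2|q2] := boolP (odd q).
  by rewrite nq mulnC; apply: oa5_mul => //; [exact: oa_4 | apply: oa5_coprime; rewrite // coprime6; lia].
have [q4|q4] := boolP (4 %| q).
  by rewrite nq; apply: oa5_mul => //; [apply: IH; lia | exact: oa_4].
have -> : n = 8 * q./2 by lia.
apply: oa5_mul; first by lia.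
  by have [L hL] := oa_8; exists L; apply: oa_sub hL => i /leqW.
by apply: oa5_coprime; rewrite ?coprime6; lia.
Qed.

Definition oa6_order n := coprime n 6 || (n \in [:: 8; 9; 16]).
Definition oa5_order n := [|| oa6_order n, (4 %| n) && (n %% 3 != 0) | n \in [:: 12; 24]].

Lemma oa6_orderP n : 0 < n -> oa6_order n -> exists L, oa n (fun i => i < 6) L.
Proof.
move=> n0 /orP[n6|]; first by eexists; apply: oa_cyclic.
by rewrite !inE => /or3P[]/eqP->; [exact: oa_8 | exact: oa_9 | exact: oa_16].
Qed.

Lemma oa5_orderP n : 0 < n -> oa5_order n -> oa5 n.
Proof.
move=> n0 /or3P[/(oa6_orderP n0)[L hL]|/andP[n4 n3]|].
- by exists L; apply: oa_sub hL => i /leqW.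
- exact: oa5_4dvd.
- by rewrite !inE => /orP[]/eqP->; [exact: oa_12 | exact: oa_24].
Qed.

(** * Pairwise balanced designs with block sizes 4, 7, 10 and 19 *)

Lemma gm_3_5_0 : dec (gm 3 5 0).
Proof.
have h : dec (gm 3 4 3) by apply: gm_design.
apply: eq_kdec h => p q _; rewrite /gm /gsize.
have e c : (if c < 4 then 3 else if c == 4 then 3 else 0) =
  (if c < 5 then 3 else if c == 5 then 0 else 0) by case: c => [|[|[|[|[|[|c]]]]]].
by rewrite !e.
Qed.

Definition ks : seq nat := [:: 4; 7; 10; 19].
Notation pbdk := (pbd (mem ks)).

(** With weight 3 the blocks become types 3^4 and 3^5, and the groups, now of [3 * n] or [3 * r]
    points, are filled together with one common new point. *)
Lemma pbdk_trunc t n r : t = 4 * n + r -> oa5 n -> 0 < n -> r <= n ->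
  pbdk (3 * n + 1) -> pbdk (3 * r + 1) -> pbdk (3 * t + 1).
Proof.
move=> -> [L hL] n0 rn hn hr; have n3 : 0 < 3 * n by rewrite muln_gt0.
apply: (@pbd_parts _ (3 * n)) => // [|i ig].
  have h45 k : pred2 4 5 k -> dec (gm 3 k 0) by case/orP=> /eqP->; [exact: gm_design | exact: gm_3_5_0].
  have s4 k : pred1 4 k -> mem ks k by move/eqP->.
  have := sub_kdec s4 (kdec_inflate (kdec_trunc hL n0 rn) h45).
  pose S (p : nat * nat) := (p.1 < 4 * n + r) && (p.2 < 3).
  have d3 x a : a < 3 -> (x * 3 + a) %/ 3 = x by move=> a3; rewrite divnMDl // divn_small // addn0.
  apply: (kdec_map (S := S) (f := fun p => p.1 * 3 + p.2)).
  - by move=> [x a] [y b] /andP[_ a3] /andP[_ b3] /= /mul_add_inj[] // -> ->.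
  - by move=> [x a] [y b] _ /and4P[/= ? ? _ /and3P[? ? _]]; rewrite /S; split; apply/andP.
  - move=> [x a] [y b] /andP[/= xn a3] /andP[/= yn b3] _; rewrite a3 b3 /= /trunc xn yn.
    rewrite !divnMA !d3 // !mul_add_ltn //=.
    by case: (eqVneq x y) => [->|_]; rewrite ?eqxx.
  - move=> x y _ /and3P[xn yn _]; exists (x %/ 3, x %% 3), (y %/ 3, y %% 3).
    by rewrite /S /= !ltn_mod !ltn_divLR // ![(4 * n + r) * 3]mulnC xn yn -!divn_eq.
have -> : minn (3 * n) (3 * (4 * n + r) - 3 * n * i) = 3 * minn n (4 * n + r - n * i).
  by rewrite -mulnA -mulnBr minnMr.
by have [|->|->] // := @minn_trunc n r i n0 rn; rewrite -(ltn_pmul2l (isT : 0 < 3)) mulnA.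
Qed.

(** Whether a window of [k] consecutive integers meets the residues in [L] depends only on the
    residue of its start, which leaves [q] cases to compute. *)
Lemma ex_mod q k (L : pred nat) a : 0 < q ->
    all (fun r => has (fun d => L ((r + d) %% q)) (iota 0 k)) (iota 0 q) ->
  exists n, [/\ a <= n, n < a + k & L (n %% q)].
Proof.
move=> q0 /allP/(_ (a %% q)); rewrite mem_iota ltn_mod q0 => /(_ isT)/hasP[d].
by rewrite mem_iota modnDml => /andP[_ dk] Ld; exists (a + d); rewrite leq_addr ltn_add2l.
Qed.

Lemma pbdk_gm u m :
  (1, u, m) \in [seq d.1.1 | d <- gm_designs] -> pbdk m -> pbdk (u + m).
Proof. by move/gm_design; apply: pbd_gm. Qed.

Lemma pbdk_mem k : k \in ks -> pbdk k.
Proof. by move=> kk; apply: sub_kdec (pbd_pred1 k) => _ /eqP->. Qed.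

(** Strong induction: if some array order [n] has [4 * n <= t <= 5 * n], then t = 4n + r with r <=
    n, and both [n] and [r] are smaller than [t]. *)
Lemma pbdkP t : pbdk (3 * t + 1).
Proof.
elim/ltn_ind: t => t IH.
have step n : oa5 n -> 0 < n -> 4 * n <= t <= 5 * n -> pbdk (3 * t + 1).
  move=> on n0 /andP[nt tn]; apply: (@pbdk_trunc t n (t - 4 * n)) => //; try lia.
    by apply: IH; lia.
  by apply: IH; lia.
have [t91|t91] := leqP 91 t.
  have [n [n1 n2 n6]] := @ex_mod 6 4 (mem [:: 1; 5]) ((t + 4) %/ 5) isT isT.
  have n0 : 0 < n by lia.
  apply: (step n) => //; last by lia.
  by apply: oa5_coprime; rewrite // coprime6; move: n6; rewrite /= !inE.
(* The intervals from [4 * n] to [5 * n] cover 16, ..., 90 except for 26 and 27. *)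
pose ns := [:: 4; 5; 7; 8; 9; 11; 13; 16; 19].
have [/hasP[n nL hn]|no] := boolP (has (fun n => 4 * n <= t <= 5 * n) ns).
  have n0 : 0 < n by move: nL; rewrite !inE; lia.
  apply: (step n) => //; apply: oa5_orderP => //.
  exact: (allP (isT : all oa5_order ns) _ nL).
have {no t91} : t \in [seq i <- iota 0 91 | ~~ has (fun n => 4 * n <= i <= 5 * n) ns].
  by rewrite mem_filter no mem_iota.
have -> : [seq i <- iota 0 91 | ~~ has (fun n => 4 * n <= i <= 5 * n) ns] =
    iota 0 16 ++ [:: 26; 27] by vm_compute.
have h7 : pbdk 7 by apply: pbdk_mem.
have h10 : pbdk 10 by apply: pbdk_mem.
rewrite mem_cat mem_iota add0n => /orP[t16|]; last first.
  have h22 : pbdk 22 by apply: (@pbdk_gm 15 7).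
  have h19 : pbdk 19 by apply: pbdk_mem.
  rewrite !inE => /orP[]/eqP->; [by apply: (@pbdk_gm 57 22) | by apply: (@pbdk_gm 63 19)].
move: t t16 IH step => [|[|[|[|[|[|[|[|[|[|[|[|[|[|[|[|//]]]]]]]]]]]]]]]] _ _ _.
- exact: pbd1.
- exact: pbdk_mem.
- exact: pbdk_mem.
- exact: pbdk_mem.
- by apply: (@pbdk_gm 12 1) => //; exact: pbd1.
- by apply: (@pbdk_gm 15 1) => //; exact: pbd1.
- exact: pbdk_mem.
- by apply: (@pbdk_gm 15 7) => //; exact: h7.
- by apply: (@pbdk_gm 24 1) => //; exact: pbd1.
- by apply: (@pbdk_gm 27 1) => //; exact: pbd1.
- by apply: (@pbdk_gm 21 10) => //; exact: h10.
- by apply: (@pbdk_gm 27 7) => //; exact: h7.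
- by apply: (@pbdk_gm 36 1) => //; exact: pbd1.
- by apply: (@pbdk_gm 39 1) => //; exact: pbd1.
- by apply: (@pbdk_gm 33 10) => //; exact: h10.
- by apply: (@pbdk_gm 36 10) => //; exact: h10.
Qed.

Lemma pbdk_mod3 g : g %% 3 = 1 -> pbdk g.
Proof. by move=> g3; have -> : g = 3 * (g %/ 3) + 1; [lia | apply: pbdkP]. Qed.

(** * Tensor products of complete graphs *)

Lemma mg_ks g u : g %% 3 = 1 -> (forall k, k \in ks -> dec (mg k u)) -> dec (mg g u).
Proof. by move=> /pbdk_mod3; apply: mg_pbd. Qed.

Lemma mg_base g u : g %% 3 = 1 -> u \in [:: 4; 5; 7; 8; 9; 11; 12; 15; 19; 27] -> dec (mg g u).
Proof.
move=> g3 uL; apply: mg_ks g3 _ => k; move: uL; rewrite !inE.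
case/or4P=> [/eqP->|/eqP->|/eqP->|/or4P[/eqP->|/eqP->|/eqP->|/or4P[]/eqP->]];
  case/or4P=> /eqP->;
  by [exact: mg_design | exact: mg_sym (mg_design _)].
Qed.

(** The tensor product being symmetric, the transversal design may be put on the other factor: its
    4n + r points carry a pairwise balanced design with block sizes 4, 5, n, r. *)
Lemma mg_trunc g n r : oa5 n -> 0 < n -> r <= n -> dec (mg g 4) -> dec (mg g 5) ->
  dec (mg g n) -> dec (mg g r) -> dec (mg g (4 * n + r)).
Proof.
move=> [L hL] n0 rn h4 h5 hn hr; apply: mg_sym.
pose K := mem [:: 4; 5; n; r].
have Kk k : K k -> pbd K k by move=> Kk; apply: sub_kdec (pbd_pred1 k) => _ /eqP->.
apply: (mg_pbd (K := K)).
  by apply: pbd_trunc hL n0 rn _ _ (Kk _ _) (Kk _ _); rewrite /K /= !inE eqxx ?orbT.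
by move=> k; rewrite /K /= !inE => /or4P[]/eqP->; apply: mg_sym.
Qed.

(** The values [u = 3 * s] at which the induction starts, for all or only some of the admissible
    [m]. *)
Definition mg_orders : seq nat :=
  [:: 9; 12; 15; 21; 24; 27; 33; 36; 39; 45; 51; 57; 63; 81; 84; 87; 99; 147].

Lemma mg_all g u : g %% 3 = 1 -> u \in mg_orders -> dec (mg g u).
Proof.
move=> g3; have b u' : u' \in [:: 4; 5; 7; 8; 9; 11; 12; 15; 19; 27] -> dec (mg g u').
  exact: mg_base.
have m0 : dec (mg g 0) by apply: mg_sym (mg1 _ _).
have m1 : dec (mg g 1) by apply: mg_sym (mg1 _ _).
have m13 : dec (mg g 13).
  apply: mg_sym; apply: (@mg_pbd (pred1 4)) => [|k /eqP->].
    by apply: (@pbd_gm _ 12 1) => //; [exact: gm_design | exact: pbd1].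
  by apply: mg_sym; apply: b.
have T n r : 0 < n -> r <= n -> oa5_order n -> dec (mg g n) -> dec (mg g r) -> dec (mg g (4 * n + r)).
  by move=> n0 rn /(oa5_orderP n0) on; apply: mg_trunc => //; apply: b.
have m16 : dec (mg g 16) by apply: (T 4 0) => //; apply: b.
have m17 : dec (mg g 17) by apply: (T 4 1) => //; apply: b.
have m20 : dec (mg g 20) by apply: (T 5 0) => //; apply: b.
have m35 : dec (mg g 35) by apply: (T 7 7) => //; apply: b.
rewrite !inE => /or4P[/eqP->|/eqP->|/eqP->|/or4P[/eqP->|/eqP->|/eqP->|/or4P[/eqP->|/eqP->|/eqP->|
  /or4P[/eqP->|/eqP->|/eqP->|/or4P[/eqP->|/eqP->|/eqP->|/or3P[]/eqP->]]]]].
- exact: b.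
- exact: b.
- exact: b.
- by apply: (T 5 1) => //; apply: b.
- by apply: (T 5 4) => //; apply: b.
- exact: b.
- by apply: (T 8 1) => //; apply: b.
- by apply: (T 8 4) => //; apply: b.
- by apply: (T 8 7) => //; apply: b.
- by apply: (T 9 9) => //; apply: b.
- by apply: (T 11 7) => //; apply: b.
- by apply: (T 13 5) => //; apply: b.
- by apply: (T 13 11) => //; apply: b.
- by apply: (T 17 13).
- by apply: (T 17 16).
- by apply: (T 19 11) => //; apply: b.
- by apply: (T 20 19) => //; apply: b.
- by apply: (T 35 7) => //; apply: b.
Qed.

(** * Existence for all orders *)

Lemma gm_oa5 g a : oa5 g -> 0 < g -> a <= g -> dec (gm (3 * g) 4 (3 * a)).
Proof. by move=> [L hL] g0 ag; apply: gm_oa hL g0 ag (gm_design _) gm_3_5_0. Qed.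

(** A transversal design of order [g] whose fifth group is cut down to [a] points settles every [g]
    except those congruent to 10 mod 12. *)
Lemma gm_3g_4_large g a : g %% 3 = 1 -> 4 <= g -> 2 <= a <= 3 -> dec (gm (3 * g) 4 (3 * a)).
Proof.
move=> g3 g4 /andP[a2 a3].
(* 30 is [3 * g] for g = 10, where no splitting into bunches is made; 6 and 18 are [3 * r] for the
   short bunch with r = 2 or 6. *)
have Q w : w \in [:: 6; 18; 30] -> dec (gm w 4 (3 * a)).
  have [->|->] : a = 2 \/ a = 3 by lia.
    by rewrite !inE => /or3P[]/eqP->; apply: gm_design.
  by rewrite !inE => /or3P[]/eqP->; apply: gm_design.
have [g6|g6] := boolP (coprime g 6).
  by apply: gm_oa5; [apply: oa5_coprime; lia | lia | lia].
have [g4d|g4d] := boolP (4 %| g).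
  by apply: gm_oa5; [apply: oa5_4dvd; lia | lia | lia].
have g12 : g %% 12 = 10 by move: g6; rewrite coprime6; lia.
have [->|g10] := eqVneq g 10; first exact: Q.
(* Here there is no array of order [g] at hand; the rows are grouped into four bunches of [n] rows and
   one of [r] instead. *)
have step n r : g = 4 * n + r -> 5 <= n -> coprime n 6 -> r \in [:: 2; 6] -> r <= n ->
    dec (gm (3 * g) 4 (3 * a)).
  move=> -> n5 n6 rr rn; have on : oa5 n by apply: oa5_coprime n6; lia.
  case: (on) => L hL; apply: (gm_trunc hL) => //; try lia.
  - exact: mg_design.
  - by apply: mg_sym; apply: mg_design.
  - exact: gm_design.
  - by apply: gm_oa5 on _ _; lia.
  - by move: rr; rewrite !inE => /orP[]/eqP->; apply: Q.
have [k gk] : exists k, g = 12 * k + 10 by exists (g %/ 12); lia.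
have [ok|ok] := boolP (odd k).
  by apply: (step (3 * k + 2) 2) => //; rewrite ?coprime6; lia.
by apply: (step (3 * k + 1) 6) => //; rewrite ?coprime6; lia.
Qed.

Lemma gm_3g_4 g x : g %% 3 = 1 -> 4 <= g -> x \in [:: 0; 3; 6; 9] -> dec (gm (3 * g) 4 x).
Proof.
move=> g3 g4; rewrite !inE => /or4P[]/eqP->.
- by apply: gm_rows; [apply: mg_base | exact: gm_design..].
- by apply: gm_rows; [apply: mg_base | exact: gm_design..].
- exact: (@gm_3g_4_large g 2).
- exact: (@gm_3g_4_large g 3).
Qed.

Lemma gm_3g_5 g x : g %% 3 = 1 -> x \in [:: 0; 6] -> dec (gm (3 * g) 5 x).
Proof.
move=> g3; rewrite !inE => /orP[]/eqP->.
- by apply: gm_rows; [apply: mg_base | exact: gm_design | exact: gm_3_5_0].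
- by apply: gm_rows; [apply: mg_base | exact: gm_design..].
Qed.

Lemma gm_base g u m : g %% 3 = 1 -> u \in mg_orders ->
  (1, u, m) \in [seq d.1.1 | d <- gm_designs] -> dec (gm g u m).
Proof.
move=> g3 uo /gm_design hm; rewrite -[g]mul1n; apply: gm_rows hm; first exact: mg_all.
apply: (@kdec_block _ _ [:: (0, 0); (1, 0); (2, 0); (3, 0)]) => // -[a i] [b j].
rewrite /gm /gsize /= !inE !xpair_eqE /=.
case: a => [|[|[|[|[|a]]]]]; case: b => [|[|[|[|[|b]]]]] //=; case: i => [|i]; case: j => [|j] //=.
all: by rewrite andbF.
Qed.

(** * Parameters of the induction on [s] *)

(** The hypotheses of the theorem for u = 3s: residues of [u] mod 12 become residues of [s] mod 4,
    and [m > 0] follows from the congruences. *)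
Definition admissible s m := (2 * m < 3 * s) &&
  [|| (s %% 4 == 0) && (m %% 3 == 1), (s %% 4 == 1) && (m %% 6 == 1) | (s %% 4 == 3) && (m %% 6 == 4)].

Lemma oa_reindex n (C C' : pred nat) (f : nat -> nat) k L :
    (forall i, C' i -> i < k) -> (forall i, C' i -> C (f i)) ->
    (forall i j, C' i -> C' j -> f i = f j -> i = j) ->
  oa n C L -> oa n C' [seq mkseq (fun i => nth 0 r (f i)) k | r <- L].
Proof.
move=> Ck CC finj [ltL cL]; split=> [_ i /mapP[r rL ->] Ci|i j x y Ci Cj ij xn yn].
  by rewrite nth_mkseq ?Ck //; apply: ltL rL (CC _ Ci).
rewrite count_map -(cL (f i) (f j) x y) ?CC //; last by apply: contra_neq ij; apply: finj.
by apply: eq_count => r /=; rewrite !nth_mkseq ?Ck.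
Qed.

(* A column of the array that is not used allows for an array with five columns only. *)
Definition step s m n (z : bool) w :=
  let: r := s - 4 * n in let: j := (m - w - 3 * z) %/ 6 in
  [&& 4 * n <= s, r + z <= n, j <= n, w + 3 * z + 6 * j == m, (3 <= n) && admissible n w,
    (r == 0) || (3 <= r) && admissible r (w + 3 * z)
  & oa6_order n || oa5_order n && ((r + z == 0) || (j == 0))].

Lemma gm_step g s m n z w : g %% 3 = 1 -> 4 <= g -> step s m n z w ->
  (forall s' m', 3 <= s' < s -> admissible s' m' -> dec (gm g (3 * s') m')) -> dec (gm g (3 * s) m).
Proof.
rewrite /step; set r := s - 4 * n; set j := _ %/ 6 => g3 g4.
case/and5P=> ns rn jn /eqP em /and3P[/andP[n3 nw] rw no] IH.
have -> : s = 4 * n + r by lia.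
have n0 : 0 < n by lia.
have [L hL] : exists L, oa n (fun i => [|| i < 4, (i == 4) && (0 < r + z) | (i == 5) && (0 < j)]) L.
  case/orP: no => [/(oa6_orderP n0)[L hL]|/andP[/(oa5_orderP n0)[L hL] /orP[/eqP rz|/eqP j0]]].
  - by exists L; apply: oa_sub hL => i; lia.
  (* Here the sixth group may be in use and the fifth is not, so column 5 is read from column 4 of
     an array with five columns. *)
  - exists [seq mkseq (fun i => nth 0 l (if i == 5 then 4 else i)) 6 | l <- L].
    rewrite rz; apply: oa_reindex hL => [i|i|i i']; first by lia.
      by case: (i =P 5) => [->|]; lia.
    by case: (i =P 5) => [->|?]; case: (i' =P 5) => [->|?]; lia.
  - by exists L; apply: oa_sub hL => i; rewrite j0; lia.
rewrite -em; apply: (gm_rec hL) => //.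
- by move=> x; apply: gm_3g_4.
- by move=> x; apply: gm_3g_5.
- by apply: IH => //; lia.
- case/orP: rw => [/eqP->|/andP[r3 rw]]; last by apply: IH => //; lia.
  (* For r = 0 the graph has a single part, hence no edges. *)
  by apply: kdec0 => p q _; rewrite /gm /gsize muln0 /=; case: (p.1 =P 0) => [->|_];
    case: (q.1 =P 0) => [->|_] //; rewrite ?andbF.
Qed.

(** The condition [s <= 5 * n] means r <= n. The candidates for [w] are its two least possible
    values, 1 and 4, and those for which j = 0 or j = n. *)
Definition has_step s m :=
  has (fun n => has (fun z : bool => has (step s m n z) [:: 1; 4; m - 3 * z; m - 3 * z - 6 * n])
    [:: false; true]) [seq n <- iota 4 (s %/ 4) | s <= 5 * n].

Lemma small_orders s m : 3 <= s < 111 -> admissible s m ->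
  (3 * s \in mg_orders) && ((1, 3 * s, m) \in [seq d.1.1 | d <- gm_designs]) || has_step s m.
Proof.
move=> /andP[s3 s111] sm; have /allP/(_ s) : all (fun s => all (fun m =>
      (3 * s \in mg_orders) && ((1, 3 * s, m) \in [seq d.1.1 | d <- gm_designs]) || has_step s m)
    [seq m <- iota 0 (3 * s) | admissible s m]) (iota 3 108) by vm_compute.
rewrite mem_iota => /(_ _)/allP; rewrite s3 => /(_ s111 m).
by rewrite mem_filter mem_iota add0n sm; apply; case/andP: sm; lia.
Qed.

Lemma step_orders n r (z : bool) j w : 3 <= n -> 3 <= r -> r + z <= n -> j <= n ->
    oa6_order n || oa5_order n && (j == 0) -> admissible n w -> admissible r (w + 3 * z) ->
  step (4 * n + r) (w + 3 * z + 6 * j) n z w.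
Proof.
move=> n3 r3 rn jn on nw rw; rewrite /step leq_addr !addKn.
have -> : w + 3 * z + 6 * j - w - 3 * z = 6 * j by lia.
rewrite mulKn // rn jn eqxx n3 nw r3 rw orbT /=.
by case/orP: on => [->|/andP[-> ->]] //; rewrite !orbT.
Qed.

(** With [n] slightly above s / 5, the remainder [r] is at most [n] yet not too small, and the pair
    (r, w + 3z) inherits its congruences from (s, m). *)
Lemma large_orders s m : 111 <= s -> admissible s m -> exists n z w, step s m n z w.
Proof.
move=> s111 sm; have [m1|m1] := eqVneq m 1.
  (* There is no room for [z = true]; hence [n] must be congruent to 0 or 1 mod 4. *)
  have [n [n1 n2 hn]] := @ex_mod 12 5 (mem [:: 1; 4; 5; 8]) ((s + 4) %/ 5) isT isT.
  move: hn; rewrite /= !inE => hn.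
  have [r sE] : exists r, s = 4 * n + r by exists (s - 4 * n); lia.
  (* By the choice of the window n <= (s + 24) / 5, so r >= (s - 96) / 5, which is at least 3 from s
     = 111 on. *)
  have rn : 3 <= r <= n by lia.
  exists n, false, 1; rewrite sE m1; apply: (@step_orders n r false 0 1) => //; rewrite ?addn0; try lia.
  - by rewrite /oa5_order /oa6_order coprime6; lia.
  - by rewrite /admissible; lia.
  - by move: sm; rewrite m1 sE /admissible; lia.
have [n [n1 n2 n6]] := @ex_mod 6 4 (mem [:: 1; 5]) ((s + 5) %/ 5) isT isT.
have {}n6 : coprime n 6 by rewrite coprime6; move: n6; rewrite /= !inE.
have n4 : n %% 4 = 1 \/ n %% 4 = 3.
  by move: n6; rewrite coprime6; lia.
have [r sE] : exists r, s = 4 * n + r by exists (s - 4 * n); lia.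
(* Strictness leaves room for the point of weight 3. The bound 5 serves the least choice of [w], for
   which w + 3z <= 7 and 14 < 3r is required. *)
have rn : 5 <= r < n by lia.
have {n1 n2 s111} n5 : 5 <= n by lia.
(* [c] is the least [w] allowed by n mod 4, and [z] is set when [m] differs from it by 3 mod 6. *)
have [c [z [cE zE]]] : exists c (z : bool), (c = 1 /\ n %% 4 = 1 \/ c = 4 /\ n %% 4 = 3) /\
    m %% 6 = (c + 3 * z) %% 6.
  have m3 : m %% 3 = 1 by move: sm; rewrite /admissible; lia.
  case: n4 => e.
    by exists 1, (m %% 6 != 1); split; [left | case: eqP => /=; lia].
  by exists 4, (m %% 6 != 4); split; [right | case: eqP => /=; lia].
(* Either w = c and points of weight 6 absorb the rest of [m], or all [n] of them are used and [w]
   takes the surplus. *)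
have [w [j [mE wc wE jn]]] : exists w j, [/\ m = w + 3 * z + 6 * j, w %% 6 = c %% 6,
    (w == c) || (w + 3 * z + 6 * n == m) & j <= n].
  have [ma|ma] := leqP m (c + 3 * z + 6 * n).
    exists c, ((m - (c + 3 * z)) %/ 6); split; rewrite ?eqxx //; last by lia.
    have : c + 3 * z <= m by move: sm; rewrite /admissible; case: z zE ma => /=; lia.
    by lia.
  exists (m - 3 * z - 6 * n), n; split=> //; lia.
move: sm; rewrite sE mE /admissible => /andP[m0 cm].
have wr : 2 * (w + 3 * z) < 3 * r by have := leq_b1 z; lia.
exists n, z, w; apply: step_orders => //; rewrite ?/admissible.
- by lia.
- by lia.
- by have := leq_b1 z; lia.
- by rewrite /oa6_order n6.
- have -> : 2 * w < 3 * n by lia.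
  by rewrite wc; case: cE => -[-> ->].
- rewrite wr; move: cm; rewrite mulnC modnMDl.
  have -> : (w + 3 * z + 6 * j) %% 6 = (w + 3 * z) %% 6 by rewrite [6 * j]mulnC addnC modnMDl.
  by have -> : (w + 3 * z + 6 * j) %% 3 = (w + 3 * z) %% 3 by lia.
Qed.

Lemma gm_exists g s m : g %% 3 = 1 -> 4 <= g -> 3 <= s -> admissible s m -> dec (gm g (3 * s) m).
Proof.
move=> g3 g4; elim/ltn_ind: s m => s IH m s3 sm.
have stepE n z w : step s m n z w -> dec (gm g (3 * s) m).
  by move/gm_step; apply=> // s' m' /andP[s'3 s's]; apply: IH.
have [s111|s111] := leqP 111 s.
  by have [n [z [w /stepE]]] := large_orders s111 sm.
have := @small_orders s m; rewrite s3 s111 => /(_ isT sm)/orP[/andP[uo hm]|].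
  exact: gm_base.
by case/hasP=> n _ /hasP[z _ /hasP[w _ /stepE]].
Qed.

(** * From decompositions to group divisible designs *)

Lemma gdd_gm g u m : 0 < g -> 1 < u -> 0 < m -> dec (gm g u m) -> exists_4GDD_gu_m1 g u m.
Proof.
move=> g0 u1 m0 [bs [hbs cbs]]; have cl := kdec_clique hbs cbs.
pose T : finType := (('I_u * 'I_g) + 'I_m)%type.
pose v (t : T) : nat * nat := match t with inl p => (val p.1, val p.2) | inr j => (u, val j) end.
have v_inj : injective v.
  move=> [[a i]|i] [[b j]|j] //= [].
  - by move=> /val_inj-> /val_inj->.
  - by move=> e; have := ltn_ord a; rewrite e ltnn.
  - by move=> e; have := ltn_ord b; rewrite -e ltnn.
  - by move=> /val_inj->.
have v_gm p : reflect (exists t, p = v t) (p.2 < gsize g u m p.1).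
  apply: (iffP idP) => [|[[[a i]|j] ->]] /=; rewrite /gsize ?ltn_ord ?ltnn ?eqxx ?ltn_ord //.
  case: p => a i /=; case: (ltnP a u) => [au ig|_]; first by exists (inl (Ordinal au, Ordinal ig)).
  by case: eqP => // -> im; exists (inr (Ordinal im)).
have v_u t : (v t).1 < u.+1 by case: t => [[a i]|j] //=; apply: ltnW; rewrite ltnS.
pose gr t := Ordinal (v_u t); pose part c := [set t | gr t == c].
have gmv x y : gm g u m (v x) (v y) = (gr x != gr y).
  rewrite /gm; have -> : (v x).2 < gsize g u m (v x).1 by apply/v_gm; exists x.
  by have -> : (v y).2 < gsize g u m (v y).1 by [apply/v_gm; exists y]; rewrite !andbT.
have card_part c : #|part c| = if c < u then g else m.
  have [cu|uc] := ltnP c u.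
    have <- : #|[set (inl (Ordinal cu, i) : T) | i : 'I_g]| = g.
      by rewrite card_imset ?card_ord // => i j [].
    apply: eq_card => t; rewrite inE; apply/eqP/imsetP => [|[i _ ->]]; last exact: val_inj.
    case: t => [[a i]|j] /(congr1 val) /= e; last by have := cu; rewrite -{1}e ltnn.
    by exists i => //; congr (inl (_, _)); apply: val_inj.
  have cE : val c = u by apply/eqP; rewrite eqn_leq uc -ltnS ltn_ord.
  have <- : #|[set (inr j : T) | j : 'I_m]| = m by rewrite card_imset ?card_ord // => i j [].
  apply: eq_card => t; rewrite inE; apply/eqP/imsetP => [|[i _ ->]]; last exact: val_inj.
  case: t => [[a i]|j] /(congr1 val) /= e; last by exists j.
  by have := ltn_ord a; rewrite e cE ltnn.
have part_inj : injective part.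
  move=> c d e; have /card_gt0P[t] : 0 < #|part c| by rewrite card_part; case: ifP.
  rewrite inE => /eqP tc; have : t \in part d by rewrite -e inE tc.
  by rewrite inE tc => /eqP.
pose G := [set part c | c : 'I_u.+1].
have trivG : trivIset G.
  apply/trivIsetP => _ _ /imsetP[c _ ->] /imsetP[d _ ->] cd; apply/pred0P => t /=.
  rewrite !inE; apply/andP => -[/eqP ec /eqP ed]; by move: cd; rewrite -ec -ed eqxx.
have pbG t : pblock G t = part (gr t) by apply: def_pblock; rewrite ?inE // imset_f.
pose blk (b : seq (nat * nat)) := [set t | v t \in b].
pose B := [set X in [seq blk b | b <- bs]].
have memB X x y : x != y -> X \in B -> x \in X -> y \in X -> gr x != gr y.
  move=> xy; rewrite inE => /mapP[b bB ->]; rewrite !inE => xb yb.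
  by rewrite -gmv; apply: cl bB xb yb _; rewrite (inj_eq v_inj).
have card1 x y : x != y -> gr x != gr y -> #|[set b in B | (x \in b) && (y \in b)]| = 1.
  move=> xy nxy; pose P (b : seq (nat * nat)) := (v x \in b) && (v y \in b).
  have : count P bs = 1 by rewrite cbs ?gmv ?nxy // (inj_eq v_inj).
  (* The blocks form a list; a count of 1 leaves one entry through the pair, and hence one set. *)
  rewrite -size_filter; case e : (filter P bs) => [|b [|]] // _; apply/eqP/cards1P.
  have memP c : (P c && (c \in bs)) = (c == b) by rewrite -mem_filter e inE.
  exists (blk b); apply/setP => X; rewrite !inE; apply/andP/eqP => [[/mapP[c cB ->]]|->].
    by rewrite !inE => xyc; congr blk; apply/eqP; rewrite -memP cB andbT.
  have := memP b; rewrite eqxx => /andP[Pb bB]; split; first by apply: map_f.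
  by rewrite !inE.
exists T, G, B; split; first split.
- apply/and3P; split=> //.
    apply/eqP/setP => t; rewrite inE; apply/bigcupP; exists (part (gr t)); last by rewrite inE.
    exact: imset_f.
  apply/imsetP => -[c _ e]; have := card_part c; rewrite -e cards0; case: ifP; lia.
- pose x : T := inl (Ordinal (ltnW u1), Ordinal g0); pose y : T := inl (Ordinal u1, Ordinal g0).
  have /eqP/cards1P[X /setP/(_ X)] := @card1 x y isT isT.
  by rewrite !inE eqxx => /andP[XB _]; apply/set0Pn; exists X; rewrite inE.
- move=> X; rewrite inE => /mapP[c cB ->]; have [uc /eqP sc] := hbs _ cB.
  (* A point of a block has a neighbour there and so is a vertex of the graph; no point is lost in
     passing to [blk]. *)
  have cv p : p \in c -> exists t, p = v t.
    move=> pc; have [q qc pq] : exists2 q, q \in c & p != q.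
      case: c uc sc pc {cB} => [|a [|b c]] //= /andP[]; rewrite inE negb_or => /andP[ab _] _ _ _.
      have [->|pa] := eqVneq p a; first by exists b; rewrite ?inE ?eqxx ?orbT.
      by exists a; rewrite ?inE ?eqxx.
    by apply/v_gm; have /and3P[] := cl _ _ _ cB pc qc pq.
  have ub : uniq [seq v t | t <- enum (blk c)] by rewrite (map_inj_uniq v_inj) enum_uniq.
  rewrite -sc cardE -(size_map v); apply/perm_size/(uniq_perm ub uc) => p.
  apply/mapP/idP => [[t]|pc]; first by rewrite mem_enum inE => tc ->.
  by have [t e] := cv _ pc; exists t => //; rewrite mem_enum inE -e.
- by move=> x y xy; rewrite !pbG (inj_eq part_inj); apply: card1.
- move=> x y xy; rewrite !pbG => /part_inj e b bB; apply/andP => -[xb yb].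
  by have := memB _ _ _ xy bB xb yb; rewrite e eqxx.
move=> s; rewrite (_ : [set X in G | _] = part @: [set c : 'I_u.+1 | (if c < u then g else m) == s]).
  rewrite (card_imset _ part_inj) -sum1dep_card big_mkcond big_ord_recr /= ltnn.
  rewrite (eq_bigr (fun=> (s == g) : nat)) => [|c _]; last by rewrite ltn_ord eq_sym; case: eqP.
  by rewrite sum_nat_const card_ord mulnC eq_sym [m == s]eq_sym; case: (s == m).
apply/setP => X; rewrite inE; apply/andP/imsetP => [[/imsetP[c _ ->]]|[c]].
  by rewrite card_part => cs; exists c; rewrite ?inE.
by rewrite inE => cs ->; rewrite card_part imset_f.
Qed.

Theorem theorem4p3 (g u m : nat) :
  4 <= g -> 4 <= u -> g %% 3 = 1 ->
  0 < m -> m <= (u - 1) %/ 2 ->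
  [\/ u %% 12 = 0 /\ m %% 3 = 1,
      u %% 12 = 3 /\ m %% 6 = 1
    | u %% 12 = 9 /\ m %% 6 = 4] ->
  exists_4GDD_gu_m1 g u m.
Proof.
move=> g4 u4 g3 m0 mu um; apply: gdd_gm => //; try lia.
have [s us] : exists s, u = 3 * s by exists (u %/ 3); case: um => -[]; lia.
rewrite us in u4 mu um *; apply: gm_exists => //; rewrite /admissible; case: um => -[]; lia.
Qed.
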